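(* For three-dimensional cyclic matching instances $\mathcal I$ with complete preference lists and agent classes $A,B,C$, both of the following tasks can be done in linear time: (i) given $\mathcal I$ and a matching $M$ in $\mathcal I$, verifying whether $M$ is $A\cup B$-popular; (ii) given $\mathcal I$, computing an $A\cup B$-popular matching in $\mathcal I$ (or reporting that none exists).
   Context: A three-dimensional cyclic matching instance with complete lists consists of three pairwise disjoint finite sets (agent classes) $A,B,C$ with $|A|=|B|=|C|=n$. Each agent in $A$ (resp. $B$, resp. $C$) has a strict preference list ranking all agents in $B$ (resp. $C$, resp. $A$); $\succ_x$ denotes the strict order of agent $x$, $y\succ_x z$ meaning that $x$ prefers $y$ to $z$. By convention $x$ itself is placed at the end of $\succ_x$ (being unmatched is worst). Linear time means linear in the size of the input, i.e. in the total length of the preference lists. A matching $M$ is a subset of $A\times B\times C$ such that each agent appears in at most one triple. If $(a,b,c)\in M$, write $M(a)=b$, $M(b)=c$, $M(c)=a$; if $x$ is in no triple of $M$, then $M(x)=x$. For matchings $M',M$ and an agent $x$, let $\mathrm{vote}_x(M',M)=1$ if $M'(x)\succ_x M(x)$, $0$ if $M'(x)=M(x)$, and $-1$ if $M(x)\succ_x M'(x)$. $M'$ is $A\cup B$-more popular than $M$ if $\sum_{x\in A\cup B}\mathrm{vote}_x(M',M)\ge 1$ (agents in $C$ do not vote). $M$ is $A\cup B$-popular if no matching is $A\cup B$-more popular than $M$. *)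

(* Defs.v *)
From mathcomp Require Export all_boot all_order all_algebra.

Set Implicit Arguments.
Unset Strict Implicit.
Unset Printing Implicit Defensive.

Import Order.TTheory GRing.Theory Num.Theory.

(** * Three-dimensional cyclic matching instances with complete lists *)

(* Each class consists of the agents named 0, ..., n-1; the sum type keeps the
   three classes pairwise disjoint. *)
Definition agent (n : nat) : Type := ('I_n + 'I_n + 'I_n)%type.
Definition agA n (a : 'I_n) : agent n := inl (inl a).
Definition agB n (b : 'I_n) : agent n := inl (inr b).
Definition agC n (c : 'I_n) : agent n := inr c.

(* Lists are written from most to least preferred. A duplicate-free n-tuple
   over 'I_n contains every element, so the lists are strict and complete. *)
Record instance (n : nat) := Instance {
  prefA : 'I_n -> n.-tuple 'I_n;
  prefB : 'I_n -> n.-tuple 'I_n;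
  prefC : 'I_n -> n.-tuple 'I_n;
  prefA_uniq : forall a, uniq (prefA a);
  prefB_uniq : forall b, uniq (prefB b);
  prefC_uniq : forall c, uniq (prefC c)
}.

Definition input_size n (I : instance n) : nat :=
  (\sum_(a < n) size (prefA I a) + \sum_(b < n) size (prefB I b)
   + \sum_(c < n) size (prefC I c))%N.

(* The agent itself comes last: being unmatched is the worst outcome. *)
Definition pref_list n (I : instance n) (x : agent n) : seq (agent n) :=
  match x with
  | inl (inl a) => rcons [seq agB b | b <- prefA I a] x
  | inl (inr b) => rcons [seq agC c | c <- prefB I b] x
  | inr c       => rcons [seq agA a | a <- prefC I c] x
  end.

Definition prefers n (I : instance n) (x y z : agent n) : bool :=
  (index y (pref_list I x) < index z (pref_list I x))%N.

Definition triple (n : nat) : Type := ('I_n * 'I_n * 'I_n)%type.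

Definition is_matching n (M : {set triple n}) : bool :=
  [forall t in M, forall u in M,
     [|| t.1.1 == u.1.1, t.1.2 == u.1.2 | t.2 == u.2] ==> (t == u)].

Definition partner n (M : {set triple n}) (x : agent n) : agent n :=
  match x with
  | inl (inl a) => if [pick t in M | t.1.1 == a] is Some t then agB t.1.2 else x
  | inl (inr b) => if [pick t in M | t.1.2 == b] is Some t then agC t.2 else x
  | inr c       => if [pick t in M | t.2 == c] is Some t then agA t.1.1 else x
  end.

Definition vote n (I : instance n) (x : agent n) (M' M : {set triple n}) : int :=
  if prefers I x (partner M' x) (partner M x) then 1%R
  else if partner M' x == partner M x then 0%R
  else (-1)%R.

Definition in_AB n (x : agent n) : bool := if x is inl _ then true else false.

Definition AB_more_popular n (I : instance n) (M' M : {set triple n}) : bool :=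
  (1 <= \sum_(x : agent n | in_AB x) vote I x M' M)%R.

Definition AB_popular n (I : instance n) (M : {set triple n}) : bool :=
  [forall M' : {set triple n}, is_matching M' ==> ~~ AB_more_popular I M' M].

(** * A word RAM *)

(* Memory is a family of arrays of words. A program mentions only finitely many
   arrays, so interleaving them gives a RAM with a single memory at the price of
   a constant factor. A scalar variable is cell 0 of an array. *)
Definition state : Type := nat -> nat -> nat.

Definition update (s : state) (x i v : nat) : state :=
  fun y j => if (y == x) && (j == i) then v else s y j.

Inductive expr : Type :=
| Const of nat
| Get of nat & expr              (* Get x e is x[e] *)
| Add of expr & expr
| Sub of expr & expr             (* truncated at 0 *)
| Mul of expr & expr
| Lt  of expr & expr             (* comparisons return 0 or 1 *)
| Eq  of expr & expr.

Inductive cmd : Type :=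
| Skip
| Put of nat & expr & expr       (* Put x e1 e2 is x[e1] := e2 *)
| Seq of cmd & cmd
| If of expr & cmd & cmd         (* nonzero means true *)
| While of expr & cmd.

(* W is the largest value a machine word can hold; a computation in which some
   value exceeds W is stuck. Letting W grow linearly with the input size amounts
   to words of logarithmic length, so that unit costs are legitimate even in the
   presence of multiplication. *)
Definition word (W v : nat) : option nat := if (v <= W)%N then Some v else None.

Fixpoint eval (W : nat) (s : state) (e : expr) : option nat :=
  let bin (f : nat -> nat -> nat) e1 e2 :=
    if eval W s e1 is Some v1 then
      if eval W s e2 is Some v2 then word W (f v1 v2) else None
    else None in
  match e with
  | Const k => word W k
  | Get x e1 => if eval W s e1 is Some i then word W (s x i) else None
  | Add e1 e2 => bin addn e1 e2
  | Sub e1 e2 => bin subn e1 e2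
  | Mul e1 e2 => bin muln e1 e2
  | Lt e1 e2 => bin (fun v1 v2 => nat_of_bool (v1 < v2)%N) e1 e2
  | Eq e1 e2 => bin (fun v1 v2 => nat_of_bool (v1 == v2)) e1 e2
  end.

Fixpoint cost (e : expr) : nat :=
  match e with
  | Const _ => 1
  | Get _ e1 => (cost e1).+1
  | Add e1 e2 | Sub e1 e2 | Mul e1 e2 | Lt e1 e2 | Eq e1 e2 =>
      (cost e1 + cost e2).+1
  end.

(* exec W p s t s': with word bound W, the program p started in s halts in s'
   after exactly t elementary steps. *)
Inductive exec (W : nat) : cmd -> state -> nat -> state -> Prop :=
| ExecSkip s : exec W Skip s 1 s
| ExecPut s x e1 e2 i v :
    eval W s e1 = Some i -> eval W s e2 = Some v ->
    exec W (Put x e1 e2) s (cost e1 + cost e2).+1 (update s x i v)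
| ExecSeq p1 p2 s1 t1 s2 t2 s3 :
    exec W p1 s1 t1 s2 -> exec W p2 s2 t2 s3 ->
    exec W (Seq p1 p2) s1 (t1 + t2)%N s3
| ExecIf e p1 p2 s v t s' :
    eval W s e = Some v -> exec W (if v != 0 then p1 else p2) s t s' ->
    exec W (If e p1 p2) s (cost e + t).+1 s'
| ExecWhileEnd e p s :
    eval W s e = Some 0 -> exec W (While e p) s (cost e).+1 s
| ExecWhileStep e p s1 v t1 s2 t2 s3 :
    eval W s1 e = Some v -> v != 0 ->
    exec W p s1 t1 s2 -> exec W (While e p) s2 t2 s3 ->
    exec W (While e p) s1 (cost e + t1 + t2).+1 s3.

Lemma exec_deterministic W p s t s' : exec W p s t s' ->
  forall t2 s2, exec W p s t2 s2 -> t = t2 /\ s' = s2.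
Proof.
elim=> {p s t s'}.
- by move=> s t2 s2 H; inversion H.
- by move=> s x e1 e2 i v h1 h2 t2 s2 H; inversion H; subst; split=> //; congruence.
- move=> p1 p2 s1 t1 s2 t2 s3 _ IH1 _ IH2 t s H; inversion H as [|?|? ? ? ? ? ? ? h1 h2| | |]; subst.
  have [? ?] := IH1 _ _ h1; subst.
  by have [? ?] := IH2 _ _ h2; subst.
- move=> e p1 p2 s v t s' h _ IH t2 s2 H; inversion H as [| | |? ? ? ? v' ? ? h1 h2| |]; subst.
  have ? : v' = v by congruence.
  by subst; have [? ?] := IH _ _ h2; subst.
- move=> e p s h t2 s2 H; inversion H as [| | | | |? ? ? v' ? ? ? ? h1 hv]; subst=> //.
  have ? : v' = 0 by congruence.
  by subst.
- move=> e p s1 v t1 s2 t2 s3 h hv _ IH1 _ IH2 t s H.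
  inversion H as [| | | |? ? ? h1|? ? ? v' ? ? ? ? h1 hv' h2 h3]; subst.
    have ? : v = 0 by congruence.
    by subst.
  have [? ?] := IH1 _ _ h2; subst.
  by have [? ?] := IH2 _ _ h3; subst.
Qed.

(* Halting within T steps on words of size at most W, in a state satisfying the
   output condition Q. By exec_deterministic, the existential quantifier speaks
   about the unique run of p from s. *)
Definition halts_within (W T : nat) (p : cmd) (s : state) (Q : state -> Prop) : Prop :=
  exists t s', [/\ exec W p s t s', (t <= T)%N & Q s'].

(** * Input and output conventions *)

(* Array k initially holds the k-th list; all remaining cells hold 0. *)
Definition load (l : seq (seq nat)) : state := fun x i => nth 0 (nth [::] l x) i.

Definition holds (s : state) (x : nat) (l : seq nat) : Prop :=
  forall i, (i < size l)%N -> s x i = nth 0 l i.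

(* Row-major: the (i+1)-st choice of agent x is in cell x * n + i. *)
Definition encode_prefs n (pref : 'I_n -> n.-tuple 'I_n) : seq nat :=
  flatten [seq [seq val y | y <- pref x] | x <- enum 'I_n].

Definition encode_triples n (ts : seq (triple n)) : seq nat :=
  flatten [seq [:: val t.1.1; val t.1.2; val t.2] | t <- ts].

Definition encode_instance n (I : instance n) : seq (seq nat) :=
  [:: [:: n]; encode_prefs (prefA I); encode_prefs (prefB I);
      encode_prefs (prefC I)].

(* Array 4 holds the number of triples and array 5 the triples, both in the
   input of verification and in the output of computation. *)
Definition encode_input n (I : instance n) (ts : seq (triple n)) : seq (seq nat) :=
  encode_instance I ++ [:: [:: size ts]; encode_triples ts].

(* ts lists the triples of M without repetition, in arbitrary order. *)
Definition lists n (ts : seq (triple n)) (M : {set triple n}) : Prop :=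
  uniq ts /\ ts =i M.

Definition outputs_matching n (s : state) (M : {set triple n}) : Prop :=
  exists ts : seq (triple n),
    [/\ lists ts M, holds s 4 [:: size ts] & holds s 5 (encode_triples ts)].

Definition answer (s : state) : nat := s 6 0.

(* Main.v *)
Require Import Defs.
From mathcomp Require Import fingroup perm zify.

(* A matching is popular only if it is perfect, because adding triples never
   loses a vote. A perfect matching is a pair of bijections A -> B and B -> C,
   and the votes of A depend only on the first, those of B only on the second,
   so popularity splits into two independent one-sided problems. A bijection s
   is popular iff everybody who is envied got their top choice: if p prefers
   s q to s p and s q is not the top choice of q, rotate p -> s q, q -> top of
   q, holder of that top -> s p. This is a linear-time test. Equivalently,
   everybody gets their top choice or the best house that is nobody's top
   choice, so a popular bijection is a perfect matching in a graph in which
   each agent has two options. Agents are inserted one at a time along a walk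
   in which every evicted agent moves to its other option; each insertion takes
   O(n) steps, and if neither walk reaches a free house then Hall's condition
   fails.

   If all loops run n times and only bits and copies of cells are stored, then
   all cells stay below n + 2 and the cost is governed by the nesting depth of
   the loops, here 2; so running time and word size reduce to syntactic checks. *)

Set Implicit Arguments.
Unset Strict Implicit.
Unset Printing Implicit Defensive.

Import Order.TTheory GRing.Theory Num.Theory.
Local Open Scope nat_scope.

(** * Bounded loops on the word RAM *)

Local Arguments word : simpl never.

Definition var (x : nat) : expr := Get x (Const 0).

(** The only loop is [For x b], whose counter is cell 0 of array [x] and whose bound [n] is cell 0
    of array 0. Meanings are therefore total functions on states. *)
Inductive prog : Type :=
| Nop
| Do of nat & expr & expr
| Then of prog & prog
| Cond of expr & prog & prog
| For of nat & prog.

Fixpoint code (p : prog) : cmd :=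
  match p with
  | Nop => Skip
  | Do x e1 e2 => Put x e1 e2
  | Then p1 p2 => Seq (code p1) (code p2)
  | Cond e p1 p2 => If e (code p1) (code p2)
  | For x b =>
      Seq (Put x (Const 0) (Const 0))
        (While (Lt (var x) (var 0))
           (Seq (code b) (Put x (Const 0) (Add (var x) (Const 1)))))
  end.

(** Evaluation without a word bound, which separates correctness from overflow. *)
Fixpoint ev (s : state) (e : expr) : nat :=
  match e with
  | Const k => k
  | Get x e1 => s x (ev s e1)
  | Add e1 e2 => ev s e1 + ev s e2
  | Sub e1 e2 => ev s e1 - ev s e2
  | Mul e1 e2 => ev s e1 * ev s e2
  | Lt e1 e2 => ev s e1 < ev s e2
  | Eq e1 e2 => ev s e1 == ev s e2
  end.

(** The loop bound is read once here but at every test in [code]; the two agree when the body writes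
    neither array 0 nor the counter, as [wf] demands. *)
Fixpoint den (p : prog) (s : state) : state :=
  match p with
  | Nop => s
  | Do x e1 e2 => update s x (ev s e1) (ev s e2)
  | Then p1 p2 => den p2 (den p1 s)
  | Cond e p1 p2 => if ev s e != 0 then den p1 s else den p2 s
  | For x b =>
      iteri (s 0 0) (fun i s' => update (den b s') x 0 i.+1) (update s x 0 0)
  end.

Fixpoint writes (p : prog) : seq nat :=
  match p with
  | Nop => [::]
  | Do x _ _ => [:: x]
  | Then p1 p2 | Cond _ p1 p2 => writes p1 ++ writes p2
  | For x b => x :: writes b
  end.

Lemma update_frame s x i v y : y != x -> update s x i v y = s y.
Proof. by rewrite /update => /negbTE ->. Qed.

Lemma den_frame p s y : y \notin writes p -> den p s y = s y.
Proof.
elim: p s => [|x e1 e2|p1 IH1 p2 IH2|e p1 IH1 p2 IH2|x b IHb] s //=.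
- by rewrite inE => /update_frame ->.
- by rewrite mem_cat negb_or => /andP[h1 h2]; rewrite IH2 // IH1.
- by rewrite mem_cat negb_or => /andP[h1 h2]; case: ifP => _; [rewrite IH1|rewrite IH2].
- rewrite inE negb_or => /andP[hx hb].
  elim: (s 0 0) => [|n IH] /=; first by rewrite update_frame.
  by rewrite update_frame // IHb.
Qed.

(** An invariant rule with framing built in: the step may assume that the counter is [i] and that
    unwritten arrays are as on entry, so invariants mention only what changes. *)
Lemma den_for (Inv : nat -> state -> Prop) n x b s :
  s 0 0 = n -> 0 \notin x :: writes b -> x \notin writes b ->
  Inv 0 (update s x 0 0) ->
  (forall i s', i < n -> s' x 0 = i ->
     (forall y, y \notin x :: writes b -> s' y = s y) ->
     Inv i s' -> Inv i.+1 (update (den b s') x 0 i.+1)) ->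
  Inv n (den (For x b) s).
Proof.
move=> sn h0 hx I0 IS /=; rewrite sn.
pose st i := iteri i (fun i s' => update (den b s') x 0 i.+1) (update s x 0 0).
suff: forall i, i <= n ->
  [/\ Inv i (st i), st i x 0 = i &
      forall y, y \notin x :: writes b -> st i y = s y].
  by move=> /(_ _ (leqnn _))[].
elim=> [|i IH] hi.
  split=> //; first by rewrite /st /= /update !eqxx.
  by move=> y; rewrite inE negb_or => /andP[hy _]; rewrite /st /= update_frame.
have [Ii xi fi] := IH (ltnW hi).
split; first exact: IS.
  by rewrite /st /= /update !eqxx.
move=> y hy; rewrite /st /= -/(st i).
have := hy; rewrite inE negb_or => /andP[hy1 hy2].
by rewrite update_frame // den_frame // fi.
Qed.

(** * Running time and word size from syntax *)

Fixpoint deg (e : expr) : nat :=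
  match e with
  | Const _ | Lt _ _ | Eq _ _ => 0
  | Get _ _ => 1
  | Add e1 e2 => maxn (deg e1) (deg e2)
  | Sub e1 _ => deg e1
  | Mul e1 e2 => deg e1 + deg e2
  end.

(** [deg] measures the growth of a value against a bound [N] on the cells. Every subexpression is
    tested because every intermediate value must fit in a word. *)
Fixpoint quadratic (e : expr) : bool :=
  (deg e <= 2) &&
  match e with
  | Const _ => true
  | Get _ e1 => quadratic e1
  | Add e1 e2 | Sub e1 e2 | Mul e1 e2 | Lt e1 e2 | Eq e1 e2 =>
      quadratic e1 && quadratic e2
  end.

(** What may be stored: bits and copies of cells preserve a positive bound on the memory. Sums and
    products occur only in addresses and tests. *)
Definition small (e : expr) : bool :=
  match e with
  | Const k => k <= 1
  | Get _ _ | Lt _ _ | Eq _ _ => true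
  | _ => false
  end.

Fixpoint wf (p : prog) : bool :=
  match p with
  | Nop => true
  | Do x e1 e2 => [&& x != 0, quadratic e1, quadratic e2 & small e2]
  | Then p1 p2 => wf p1 && wf p2
  | Cond e p1 p2 => [&& quadratic e, wf p1 & wf p2]
  | For x b => [&& x != 0, x \notin writes b & wf b]
  end.

Fixpoint depth (p : prog) : nat :=
  match p with
  | Nop | Do _ _ _ => 0
  | Then p1 p2 | Cond _ p1 p2 => maxn (depth p1) (depth p2)
  | For _ b => (depth b).+1
  end.

Definition bounded (N : nat) (s : state) : Prop := forall x i, s x i <= N.

Lemma leq_powers N K L d e : 0 < N -> K <= L -> d <= e -> K * N ^ d <= L * N ^ e.
Proof. by move=> N0 hK hd; rewrite leq_mul // leq_pexp2l. Qed.

(** [K] depends on the expression alone. The binary operators share the argument [bin], which asks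
    only for a bound on the operation itself. *)
Lemma eval_ev e : quadratic e ->
  exists K, forall N W s, 0 < N -> bounded N s -> K * N ^ 2 <= W ->
    eval W s e = Some (ev s e) /\ ev s e <= K * N ^ deg e.
Proof.
have bin (e1 e2 : expr) (f : nat -> nat -> nat) (d : nat) :
    d <= 2 ->
    (exists K, forall N W s, 0 < N -> bounded N s -> K * N ^ 2 <= W ->
      eval W s e1 = Some (ev s e1) /\ ev s e1 <= K * N ^ deg e1) ->
    (exists K, forall N W s, 0 < N -> bounded N s -> K * N ^ 2 <= W ->
      eval W s e2 = Some (ev s e2) /\ ev s e2 <= K * N ^ deg e2) ->
    (forall K1 K2, exists K, forall N v1 v2, 0 < N -> v1 <= K1 * N ^ deg e1 ->
      v2 <= K2 * N ^ deg e2 -> f v1 v2 <= K * N ^ d) ->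
    exists K, forall N W s, 0 < N -> bounded N s -> K * N ^ 2 <= W ->
      (if eval W s e1 is Some v1 then
         if eval W s e2 is Some v2 then word W (f v1 v2) else None
       else None) = Some (f (ev s e1) (ev s e2))
      /\ f (ev s e1) (ev s e2) <= K * N ^ d.
  move=> hd [K1 h1] [K2 h2] hf; have [K h] := hf K1 K2.
  (* With the sum, one threshold on [W] serves both operands and the result. *)
  exists (K1 + K2 + K) => N W s N0 bs hW.
  have b1 : K1 * N ^ 2 <= W by apply: leq_trans hW; rewrite leq_mul2r; lia.
  have b2 : K2 * N ^ 2 <= W by apply: leq_trans hW; rewrite leq_mul2r; lia.
  have [-> v1] := h1 N W s N0 bs b1; have [-> v2] := h2 N W s N0 bs b2.
  have hv := h _ _ _ N0 v1 v2.
  have hv' : f (ev s e1) (ev s e2) <= (K1 + K2 + K) * N ^ d.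
    by apply: leq_trans hv _; rewrite leq_mul2r leq_addl orbT.
  split=> //; rewrite /word ifT //; apply: leq_trans hW.
  by apply: leq_trans hv' _; apply: leq_powers.
have cmp e1 e2 (b : nat -> nat -> bool) (K1 K2 : nat) : exists K, forall N v1 v2,
    0 < N -> v1 <= K1 * N ^ deg e1 -> v2 <= K2 * N ^ deg e2 ->
    nat_of_bool (b v1 v2) <= K * N ^ 0.
  by exists 1 => N v1 v2 _ _ _; case: b.
elim: e => [k|x e1 IH1|e1 IH1 e2 IH2|e1 IH1 e2 IH2|e1 IH1 e2 IH2|e1 IH1 e2 IH2|e1 IH1 e2 IH2]
  /=.
- move=> _; exists k => N W s N0 bs hW; split; last by rewrite expn0 muln1.
  by rewrite /word ifT //; apply: leq_trans hW; rewrite leq_pmulr // expn_gt0 N0.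
- move=> /IH1[K h]; exists K.+1 => N W s N0 bs hW.
  have [-> _] : eval W s e1 = Some (ev s e1) /\ ev s e1 <= K * N ^ deg e1.
    by apply: h => //; apply: leq_trans hW; rewrite leq_mul2r leqnSn orbT.
  have hs : s x (ev s e1) <= K.+1 * N ^ 1.
    by apply: leq_trans (bs _ _) _; rewrite expn1 leq_pmull.
  split=> //; rewrite /word ifT //; apply: leq_trans hW.
  by apply: leq_trans hs _; apply: leq_powers.
- move=> /and3P[hd /IH1 h1 /IH2 h2]; apply: (bin e1 e2 addn) => // K1 K2.
  exists (K1 + K2) => N v1 v2 N0 l1 l2; rewrite mulnDl leq_add //.
    by apply: leq_trans l1 _; apply: leq_powers => //; rewrite leq_maxl.
  by apply: leq_trans l2 _; apply: leq_powers => //; rewrite leq_maxr.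
- move=> /and3P[hd /IH1 h1 /IH2 h2]; apply: (bin e1 e2 subn) => // K1 K2.
  by exists K1 => N v1 v2 N0 l1 l2; apply: leq_trans l1; apply: leq_subr.
- move=> /and3P[hd /IH1 h1 /IH2 h2]; apply: (bin e1 e2 muln) => // K1 K2.
  by exists (K1 * K2) => N v1 v2 N0 l1 l2; rewrite expnD mulnACA leq_mul.
- move=> /andP[/IH1 h1 /IH2 h2].
  exact: (bin e1 e2 (fun v1 v2 => nat_of_bool (v1 < v2)) 0 isT h1 h2 (cmp _ _ _)).
- move=> /andP[/IH1 h1 /IH2 h2].
  exact: (bin e1 e2 (fun v1 v2 => nat_of_bool (v1 == v2)) 0 isT h1 h2 (cmp _ _ _)).
Qed.

Lemma ev_small N s e : 0 < N -> bounded N s -> small e -> ev s e <= N.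
Proof.
move=> N0 bs; case: e => //= [k hk|e1 e2 _|e1 e2 _]; first exact: leq_trans hk N0.
  by case: (_ < _).
by case: (_ == _).
Qed.

Lemma bounded_update N s x i v : bounded N s -> v <= N -> bounded N (update s x i v).
Proof. by move=> bs hv y j; rewrite /update; case: ifP. Qed.

(** [K] depends on the program alone. The memory bound [N] is preserved throughout, so a loop runs
    at most [N] times and raises the exponent of the time bound by one. *)
Lemma exec_den p : wf p ->
  exists K, forall N W s, 0 < N -> bounded N s -> K * N ^ 2 <= W ->
    bounded N (den p s) /\
    exists2 t, exec W (code p) s t (den p s) & t <= K * N ^ depth p.
Proof.
elim: p => [|x e1 e2|p1 IH1 p2 IH2|e p1 IH1 p2 IH2|x b IHb] /=.
- move=> _; exists 1 => N W s N0 bs hW; split=> //.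
  by exists 1; [apply: ExecSkip|rewrite expn0].
- move=> /and4P[x0 /eval_ev[K1 h1] /eval_ev[K2 h2] he].
  exists (K1 + K2 + (cost e1 + cost e2).+1) => N W s N0 bs hW.
  have [v1 _] : eval W s e1 = Some (ev s e1) /\ ev s e1 <= K1 * N ^ deg e1.
    by apply: h1 => //; apply: leq_trans hW; rewrite leq_mul2r; lia.
  have [v2 _] : eval W s e2 = Some (ev s e2) /\ ev s e2 <= K2 * N ^ deg e2.
    by apply: h2 => //; apply: leq_trans hW; rewrite leq_mul2r; lia.
  split; first by apply: bounded_update => //; apply: ev_small.
  by exists (cost e1 + cost e2).+1; [apply: ExecPut|rewrite expn0; lia].
- move=> /andP[/IH1[K1 h1] /IH2[K2 h2]].
  exists (K1 + K2) => N W s N0 bs hW.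
  have [|b1 [t1 r1 l1]] := h1 N W s N0 bs.
    by apply: leq_trans hW; rewrite leq_mul2r; lia.
  have [|b2 [t2 r2 l2]] := h2 N W _ N0 b1.
    by apply: leq_trans hW; rewrite leq_mul2r; lia.
  split=> //; exists (t1 + t2); first exact: ExecSeq r1 r2.
  rewrite mulnDl leq_add //.
    by apply: leq_trans l1 _; apply: leq_powers => //; rewrite leq_maxl.
  by apply: leq_trans l2 _; apply: leq_powers => //; rewrite leq_maxr.
- move=> /and3P[/eval_ev[K0 h0] /IH1[K1 h1] /IH2[K2 h2]].
  exists (K0 + K1 + K2 + (cost e).+1) => N W s N0 bs hW.
  have [v0 _] : eval W s e = Some (ev s e) /\ ev s e <= K0 * N ^ deg e.
    by apply: h0 => //; apply: leq_trans hW; rewrite leq_mul2r; lia.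
  have [|b1 [t1 r1 l1]] := h1 N W s N0 bs.
    by apply: leq_trans hW; rewrite leq_mul2r; lia.
  have [|b2 [t2 r2 l2]] := h2 N W s N0 bs.
    by apply: leq_trans hW; rewrite leq_mul2r; lia.
  have Nd : 0 < N ^ maxn (depth p1) (depth p2) by rewrite expn_gt0 N0.
  have l1' : t1 <= K1 * N ^ maxn (depth p1) (depth p2).
    by apply: leq_trans l1 _; apply: leq_powers => //; rewrite leq_maxl.
  have l2' : t2 <= K2 * N ^ maxn (depth p1) (depth p2).
    by apply: leq_trans l2 _; apply: leq_powers => //; rewrite leq_maxr.
  case: ifP => hv; split=> //.
    exists (cost e + t1).+1; first by apply: ExecIf v0 _; rewrite hv.
    by nia.
  exists (cost e + t2).+1; first by apply: ExecIf v0 _; rewrite hv.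
  by nia.
- move=> /and3P[x0 xb wb]; have [K h] := IHb wb.
  (* Initialization costs 3, each iteration 12 beyond its body, and the final failing test 6. *)
  exists (K + 21) => N W s N0 bs hW.
  have hN : N <= W.
    by apply: leq_trans hW; rewrite expnS expn1; nia.
  have h1 : 1 <= W by apply: leq_trans hN.
  have fit v : v <= N -> word W v = Some v.
    by move=> hv; rewrite /word (leq_trans hv hN).
  have f0 : word W 0 = Some 0 by apply: fit.
  have f1 : word W 1 = Some 1 by apply: fit.
  pose st i := iteri i (fun i s' => update (den b s') x 0 i.+1) (update s x 0 0).
  have w0 : 0 \notin writes b.
    move: wb; clear; elim: b => [|x e1 e2|p1 IH1 p2 IH2|e p1 IH1 p2 IH2|x b IHb] //=.
    - by move=> /and4P[x0 _ _ _]; rewrite inE eq_sym.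
    - by move=> /andP[/IH1 h1 /IH2 h2]; rewrite mem_cat negb_or h1.
    - by move=> /and3P[_ /IH1 h1 /IH2 h2]; rewrite mem_cat negb_or h1.
    - by move=> /and3P[x0 _ /IHb hb]; rewrite inE negb_or eq_sym x0.
  have xst i : st i x 0 = i by case: i => [|i]; rewrite /st /= /update !eqxx.
  have nst i : st i 0 0 = s 0 0.
    have x0' : (0 == x) = false by rewrite eq_sym (negbTE x0).
    elim: i => [|i IH]; rewrite /st /= ?{1}/update ?x0' //= ?den_frame //.
  have bst i : i <= s 0 0 -> bounded N (st i).
    elim: i => [|i IH] hi; first exact: bounded_update.
    rewrite /st /=; apply: bounded_update; last exact: leq_trans hi (bs _ _).
    have [] // := h N W (st i) N0 (IH (ltnW hi)).
    by apply: leq_trans hW; rewrite leq_mul2r leq_addr orbT.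
  have evg i : i <= s 0 0 -> eval W (st i) (Lt (var x) (var 0)) = Some (nat_of_bool (i < s 0 0)).
    move=> hi /=; rewrite xst nst !fit ?bs ?(leq_trans hi) ?bs //.
    by case: (_ < _).
  (* Induction on the number [k] of iterations left. *)
  have loop k i : i + k = s 0 0 ->
      exists2 t, exec W (While (Lt (var x) (var 0))
                    (Seq (code b) (Put x (Const 0) (Add (var x) (Const 1)))))
                  (st i) t (st (s 0 0)) &
                 t <= k * (K * N ^ depth b + 12) + 6.
    elim: k i => [|k IH] i hik.
      rewrite addn0 in hik; rewrite -hik.
      exists (cost (Lt (var x) (var 0))).+1 => //.
      by apply: ExecWhileEnd; rewrite evg ?hik // ltnn.
    have hi : i < s 0 0 by lia.
    have [|b1 [t1 r1 l1]] := h N W (st i) N0 (bst _ (ltnW hi)).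
      by apply: leq_trans hW; rewrite leq_mul2r leq_addr orbT.
    have [t2 r2 l2] := IH i.+1 ltac:(lia).
    exists ((cost (Lt (var x) (var 0)) + (t1 + (cost (Const 0) + cost (Add (var x) (Const 1))).+1) + t2).+1).
      apply: (@ExecWhileStep _ _ _ _ 1 _ (st i.+1)) => //.
        by rewrite evg ?hi // ltnW.
      apply: ExecSeq r1 _; apply: ExecPut => /=; first exact: f0.
      have nx : den b (st i) x 0 = i by rewrite den_frame // xst.
      rewrite ?f0 nx ?f1 !fit ?addn1 //.
        exact: leq_trans hi (bs _ _).
      exact: leq_trans (ltnW hi) (bs _ _).
    by rewrite /=; nia.
  split; first exact: bst.
  have [t r l] := loop (s 0 0) 0 erefl.
  exists ((cost (Const 0) + cost (Const 0)).+1 + t).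
    apply: ExecSeq r; apply: ExecPut => //=.
  have Nd : 0 < N ^ depth b by rewrite expn_gt0 N0.
  have := bs 0 0; move: l; rewrite expnS /=; set M := N ^ depth b in Nd *.
  move=> l hn; apply: (@leq_trans (3 + (N * (K * M + 12) + 6))).
    by rewrite leq_add2l; apply: leq_trans l _; rewrite leq_add2r leq_mul2r hn orbT.
  have : 0 < N * M by rewrite muln_gt0 N0.
  have : N <= N * M by rewrite leq_pmulr.
  by nia.
Qed.

(** The memory bound [n.+1] is positive even for [n = 0], and its square is at most twice
    [3 * n ^ 2 + 1], where [3 * n ^ 2] is the input size. *)
Lemma exec_linear p : wf p -> depth p <= 2 ->
  exists k, forall n (s : state), s 0 0 = n -> bounded n.+1 s ->
    forall Q : state -> Prop, Q (den p s) ->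
    halts_within (k * (3 * n ^ 2 + 1)) (k * (3 * n ^ 2 + 1)) (code p) s Q.
Proof.
move=> wp dp; have [K h] := exec_den wp.
exists (2 * K) => n s sn bs Q hQ.
have hN : K * n.+1 ^ 2 <= 2 * K * (3 * n ^ 2 + 1) by nia.
have [_ [t r l]] := h n.+1 _ s (ltn0Sn n) bs hN.
exists t, (den p s); split=> //.
by apply: leq_trans l _; apply: leq_trans hN; apply: leq_powers.
Qed.

(** * Popularity as a condition on two bijections *)

Definition rank n (l : n.-tuple 'I_n) (y : 'I_n) : nat := index y l.

Definition rank_vote n (l : n.-tuple 'I_n) (y z : 'I_n) : int :=
  if (rank l y < rank l z)%N then 1%R else if y == z then 0%R else (-1)%R.

Definition popular_perm n (l : 'I_n -> n.-tuple 'I_n) (s : {perm 'I_n}) : Prop :=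
  forall s' : {perm 'I_n}, (\sum_x rank_vote (l x) (s' x) (s x) <= 0)%R.

Definition envied_get_top n (l : 'I_n -> n.-tuple 'I_n) (s : {perm 'I_n}) : Prop :=
  forall p q, rank (l p) (s q) < rank (l p) (s p) -> rank (l q) (s q) = 0.

(** A charging argument: an agent [x] who gains takes its new house from an agent [pi x] whom it
    envied. That agent had its top choice and now loses. As [pi] is a bijection, gains do not
    outnumber losses. *)
Lemma envied_get_top_popular n (l : 'I_n -> n.-tuple 'I_n) s :
  envied_get_top l s -> popular_perm l s.
Proof.
move=> env s'.
pose pro x : int := ((rank (l x) (s' x) < rank (l x) (s x))%N)%:R%R.
pose con x : int := ((rank (l x) (s x) == 0) && (s' x != s x))%:R%R.
(* [pi x] is the holder under [s] of the house that [x] receives under [s']. *)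
pose pi := (s' * s^-1)%g.
have hpi x : s (pi x) = s' x by rewrite /pi permM permKV.
have vote_le x : (rank_vote (l x) (s' x) (s x) <= pro x - con x)%R.
  rewrite /rank_vote /pro /con.
  case: ltnP => [h|h]; first by have -> : (rank (l x) (s x) == 0) = false by apply/gtn_eqF/(leq_ltn_trans _ h).
  by case: (s' x == s x); case: (_ == 0).
have pro_le x : (pro x <= con (pi x))%R.
  rewrite /pro /con; case: ltnP => h; last by case: (_ && _).
  have hx : rank (l x) (s (pi x)) < rank (l x) (s x) by rewrite hpi.
  rewrite (env _ _ hx) eqxx /=; case: eqP => // e.
  have /perm_inj ex : s' (pi x) = s' x by rewrite e hpi.
  by move: h; rewrite -hpi ex ltnn.
apply: (le_trans (ler_sum _ (fun x _ => vote_le x))).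
rewrite sumrB subr_le0 [X in (_ <= X)%R](reindex_inj (@perm_inj _ pi)).
by apply: ler_sum => x _.
Qed.

Lemma popular_envied_get_top n (l : 'I_n -> n.-tuple 'I_n) s :
  (forall x, uniq (l x)) -> popular_perm l s -> envied_get_top l s.
Proof.
move=> ul pop p q hpq; apply/eqP; apply: contraT => hq.
have n0 : 0 < n by apply: leq_ltn_trans (ltn_ord p).
pose h := tnth (l q) (Ordinal n0).
have hr : rank (l q) h = 0.
  by rewrite /rank /h (tnth_nth h) index_uniq ?size_tuple.
pose r := (s^-1 h)%g.
have sr : s r = h by rewrite /r permKV.
have npq : p != q by apply: contraTneq hpq => ->; rewrite ltnn.
have nrq : r != q by apply: contraNneq hq => e; rewrite -e sr e hr.
(* The rotation sending [p] to [q], [q] to [r] and [r] to [p]; for [r = p] it is the swap of [p] and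
   [q]. *)
pose pi := (tperm p q * tperm p r)%g.
have pip : s (pi p) = s q.
  by rewrite /pi permM tpermL tpermD // eq_sym.
have piq : s (pi q) = h by rewrite /pi permM tpermR tpermL sr.
have pix x : x != p -> x != q -> x != r -> pi x = x.
  by move=> xp xq xr; rewrite /pi permM !tpermD // eq_sym.
have := pop (pi * s)%g; rewrite leNgt => /negP[].
(* A lower bound on the votes for the rotation. Its sum is 1 also when [r = p], where the bound at
   [p] is merely 0. *)
pose low x : int := ((x == p)%:R + (x == q)%:R - (x == r)%:R)%R.
have sumlow : (\sum_x low x = 1)%R.
  have delta y : (\sum_(x : 'I_n) (x == y)%:R = 1 :> int)%R.
    rewrite (bigD1 y) //= eqxx big1 ?addr0 // => x /negbTE -> //.
  by rewrite sumrB big_split /= !delta addrK.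
rewrite gtz0_ge1 -sumlow; apply: ler_sum => x _.
rewrite permM /low.
have [->|xp] := eqVneq x p.
  rewrite pip /rank_vote hpq (negbTE npq) addr0.
  by case: (p == r).
have [->|xq] := eqVneq x q.
  by rewrite piq /rank_vote hr lt0n hq eq_sym (negbTE nrq).
have [->|xr] := eqVneq x r.
  by rewrite /rank_vote; case: ifP => // _; case: ifP.
by rewrite pix // /rank_vote ltnn eqxx.
Qed.

(** * Matchings as pairs of bijections *)

Section Matchings.
Variables (n : nat) (I : instance n).
Implicit Types (M : {set triple n}) (s t : {perm 'I_n}).

Definition perm_matching s t : {set triple n} := [set (a, s a, t (s a)) | a : 'I_n].

Lemma matchingP M :
  reflect {in M &, forall u v, [|| u.1.1 == v.1.1, u.1.2 == v.1.2 | u.2 == v.2] -> u = v}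
    (is_matching M).
Proof.
apply: (iffP forall_inP) => [h u v uM vM e|h u uM].
  by move/forall_inP: (h u uM) => /(_ v vM) /implyP /(_ e) /eqP.
by apply/forall_inP => v vM; apply/implyP => e; apply/eqP/h.
Qed.

Lemma is_matching_perm s t : is_matching (perm_matching s t).
Proof.
apply/matchingP => u v /imsetP[a _ ->] /imsetP[b _ ->] /=.
by rewrite !(inj_eq perm_inj) !orbb => /eqP ->.
Qed.

Lemma card_perm_matching s t : #|perm_matching s t| = n.
Proof. by rewrite card_imset ?card_ord // => a b []. Qed.

Lemma matching_proj_inj M : is_matching M ->
  [/\ {in M &, injective (fun u : triple n => u.1.1)},
      {in M &, injective (fun u : triple n => u.1.2)} &
      {in M &, injective (fun u : triple n => u.2)}].
Proof.
move=> /matchingP h; split=> u v uM vM e; apply: h => //.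
- by rewrite e eqxx.
- by rewrite e eqxx orbT.
- by rewrite e eqxx !orbT.
Qed.

Lemma card_matching M : is_matching M -> #|M| <= n.
Proof.
case/matching_proj_inj => h _ _; rewrite -(card_in_imset h).
by rewrite -[X in _ <= X]card_ord max_card.
Qed.

(** Each projection is injective on [M], hence onto by counting. So every agent of [A] and of [B]
    lies in a triple, from which its partner can be read. *)
Lemma full_matchingP M : is_matching M -> #|M| = n ->
  exists s t, M = perm_matching s t.
Proof.
move=> mM cM; have [iA iB iC] := matching_proj_inj mM.
have surj (f : triple n -> 'I_n) : {in M &, injective f} -> f @: M = setT.
  by move=> h; apply/eqP; rewrite eqEcard subsetT cardsT card_ord card_in_imset // cM /=.
have exA a : exists u, (u \in M) && (u.1.1 == a).
    have : a \in [set u.1.1 | u in M] by rewrite (surj _ iA) inE.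
  by case/imsetP => u uM ->; exists u; rewrite uM eqxx.
have exB b : exists u, (u \in M) && (u.1.2 == b).
  have : b \in [set u.1.2 | u in M] by rewrite (surj _ iB) inE.
  by case/imsetP => u uM ->; exists u; rewrite uM eqxx.
pose uA a := xchoose (exA a); pose uB b := xchoose (exB b).
have uAP a : uA a \in M /\ (uA a).1.1 = a by have /andP[? /eqP] := xchooseP (exA a).
have uBP b : uB b \in M /\ (uB b).1.2 = b by have /andP[? /eqP] := xchooseP (exB b).
have injs : injective (fun a => (uA a).1.2).
  move=> a a' /(iB _ _ (uAP a).1 (uAP a').1) e.
  by rewrite -(uAP a).2 e (uAP a').2.
have injt : injective (fun b => (uB b).2).
  move=> a a' /(iC _ _ (uBP a).1 (uBP a').1) e.
  by rewrite -(uBP a).2 e (uBP a').2.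
exists (perm injs), (perm injt).
apply/esym/eqP; rewrite eqEcard card_perm_matching cM leqnn andbT.
apply/subsetP => _ /imsetP[a _ ->]; rewrite !permE.
have e : uB (uA a).1.2 = uA a.
  by apply: iB (uBP _).1 (uAP _).1 _; rewrite (uBP _).2.
by rewrite e -{1}(uAP a).2 -!surjective_pairing; apply: (uAP a).1.
Qed.

(** As long as fewer than [n] triples are used, each class has a free agent, and three free agents
    form a further triple. An inclusion-maximal matching is thus full. *)
Lemma matching_extension M : is_matching M ->
  exists s t, M \subset perm_matching s t.
Proof.
move=> /(@maxset_exists _ (@is_matching n)) [N /maxsetP[mN maxN] sub].
suff cN : #|N| = n.
  by have [s [t e]] := full_matchingP mN cN; exists s, t; rewrite -e.
apply/eqP; rewrite eqn_leq card_matching // leqNgt; apply/negP => cN.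
have [iA iB iC] := matching_proj_inj mN.
have free (f : triple n -> 'I_n) : {in N &, injective f} -> exists a, a \notin f @: N.
  move=> h; apply/existsP; rewrite -negb_forall; apply: contraTN cN => /forallP all.
  rewrite -leqNgt -(card_in_imset h) -[X in X <= _]card_ord -cardsT.
  by apply/subset_leq_card/subsetP => a _.
have [a ha] := free _ iA; have [b hb] := free _ iB; have [c hc] := free _ iC.
have fresh u : u \in N -> [|| u.1.1 == a, u.1.2 == b | u.2 == c] = false.
  move=> uN; apply/negbTE; rewrite !negb_or; apply/and3P; split.
  - by apply: contraNneq ha => <-; apply: imset_f.
  - by apply: contraNneq hb => <-; apply: imset_f.
  - by apply: contraNneq hc => <-; apply: imset_f.
have e : (a, b, c) |: N = N.
  apply: maxN; last exact: subsetUr.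
  apply/matchingP => u v; rewrite !inE => /predU1P[->|uN] /predU1P[->|vN] //=.
  - by rewrite eq_sym [b == _]eq_sym [c == _]eq_sym fresh.
  - by rewrite fresh.
  - by move/matchingP: mN; apply.
by move: ha; rewrite -e imsetU1 !inE eqxx.
Qed.

Lemma partner_perm_A s t a : partner (perm_matching s t) (agA a) = agB (s a).
Proof.
rewrite /partner /agA; case: pickP => [u|/(_ (a, s a, t (s a)))].
  by case/andP => /imsetP[a' _ ->] /= /eqP ->.
by rewrite /= eqxx andbT imset_f.
Qed.

Lemma partner_perm_B s t b : partner (perm_matching s t) (agB b) = agC (t b).
Proof.
rewrite /partner /agB; case: pickP => [u|/(_ ((s^-1)%g b, b, t b))].
  by case/andP => /imsetP[a' _ ->] /= /eqP ->.
move/negbT; rewrite /= eqxx andbT => /imsetP[]; exists ((s^-1)%g b) => //.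
by rewrite permKV.
Qed.

Lemma partner_sub M s t x : M \subset perm_matching s t -> in_AB x ->
  partner M x = x \/ partner M x = partner (perm_matching s t) x.
Proof.
move=> /subsetP sub; case: x => [[a|b]|c] // _.
  rewrite partner_perm_A /partner /agA; case: pickP => [u|]; last by left.
  by case/andP => /sub /imsetP[a' _ ->] /= /eqP ->; right.
rewrite partner_perm_B /partner /agB; case: pickP => [u|]; last by left.
by case/andP => /sub /imsetP[a' _ ->] /= /eqP ->; right.
Qed.

Lemma mem_pref (l : n.-tuple 'I_n) y : uniq l -> y \in l.
Proof.
move=> ul; have sub : {subset l <= enum 'I_n} by move=> ? _; rewrite mem_enum.
have sz : size (enum 'I_n) <= size l by rewrite size_tuple -cardE card_ord.
by have [_ ->] := uniq_min_size ul sub sz; rewrite mem_enum.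
Qed.

Lemma index_pref_A a b : index (agB b) (pref_list I (agA a)) = rank (prefA I a) b.
Proof.
rewrite /= -cats1 index_cat mem_map; last by move=> ? ? [].
by rewrite mem_pref ?prefA_uniq // index_map // => ? ? [].
Qed.

Lemma index_pref_B b c : index (agC c) (pref_list I (agB b)) = rank (prefB I b) c.
Proof.
rewrite /= -cats1 index_cat mem_map; last by move=> ? ? [].
by rewrite mem_pref ?prefB_uniq // index_map // => ? ? [].
Qed.

Lemma index_pref_self x : in_AB x -> index x (pref_list I x) = n.
Proof.
case: x => [[a|b]|c] //= _; rewrite -cats1 index_cat ifN ?size_map ?size_tuple.
- by rewrite /= eqxx addn0.
- by apply/negP => /mapP[].
- by rewrite /= eqxx addn0.
- by apply/negP => /mapP[].
Qed.

Lemma vote_perm_A s t s' t' a :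
  vote I (agA a) (perm_matching s' t') (perm_matching s t)
  = rank_vote (prefA I a) (s' a) (s a).
Proof. by rewrite /vote /prefers !partner_perm_A !index_pref_A. Qed.

Lemma vote_perm_B s t s' t' b :
  vote I (agB b) (perm_matching s' t') (perm_matching s t)
  = rank_vote (prefB I b) (t' b) (t b).
Proof. by rewrite /vote /prefers !partner_perm_B !index_pref_B. Qed.

Lemma index_perm_partner s t x : in_AB x ->
  index (partner (perm_matching s t) x) (pref_list I x) < n.
Proof.
case: x => [[a|b]|c] // _.
  rewrite partner_perm_A index_pref_A /rank -[X in _ < X](size_tuple (prefA I a)).
  by rewrite index_mem mem_pref ?prefA_uniq.
rewrite partner_perm_B index_pref_B /rank -[X in _ < X](size_tuple (prefB I b)).
by rewrite index_mem mem_pref ?prefB_uniq.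
Qed.

(** Under [M] the agent [x] has either the partner it has in the extension or itself, its worst
    outcome. *)
Lemma vote_extension M s t x N : in_AB x -> M \subset perm_matching s t ->
  is_matching N -> (vote I x M N <= vote I x (perm_matching s t) N)%R.
Proof.
move=> hx sub mN; have [s' [t' sub']] := matching_extension mN.
case: (partner_sub sub hx) => [e|e]; last by rewrite /vote e.
have lt := index_perm_partner s t hx.
have self := index_pref_self hx.
rewrite /vote e /prefers self.
case: (partner_sub sub' hx) => [->|->].
  by rewrite self lt ltnn eqxx.
have lt' := index_perm_partner s' t' hx.
rewrite ltnNge (ltnW lt') /= ifN; first by case: ifP => // _; case: ifP.
by apply: contraTneq lt' => <-; rewrite self ltnn.
Qed.

Lemma sum_AB (F : agent n -> int) :
  (\sum_(x : agent n | in_AB x) F x = \sum_a F (agA a) + \sum_b F (agB b))%R.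
Proof.
rewrite big_sumType /= [X in (_ + X)%R]big_pred0 // addr0.
by rewrite big_sumType.
Qed.

Lemma rank_vote_self (l : n.-tuple 'I_n) y : rank_vote l y y = 0%R.
Proof. by rewrite /rank_vote ltnn eqxx. Qed.

Lemma AB_popular_perm s t : AB_popular I (perm_matching s t) <->
  popular_perm (prefA I) s /\ popular_perm (prefB I) t.
Proof.
have sumv s' t' : (\sum_(x : agent n | in_AB x)
    vote I x (perm_matching s' t') (perm_matching s t)
  = \sum_a rank_vote (prefA I a) (s' a) (s a)
    + \sum_b rank_vote (prefB I b) (t' b) (t b))%R.
  rewrite sum_AB; congr (_ + _)%R; apply: eq_bigr => x _.
    exact: vote_perm_A.
  exact: vote_perm_B.
split=> [/forall_inP pop|[popA popB]].
  (* Challengers that keep [t], or keep [s], isolate the votes of one class: the other class votes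
     0. *)
  have main s' t' := pop _ (is_matching_perm s' t').
  split=> [s'|t'].
    move: (main s' t); rewrite /AB_more_popular sumv -gtz0_ge1 -leNgt.
    rewrite [X in (_ + X)%R]big1 ?addr0 // => b _; exact: rank_vote_self.
  move: (main s t'); rewrite /AB_more_popular sumv -gtz0_ge1 -leNgt.
  rewrite big1 ?add0r // => b _; exact: rank_vote_self.
(* An arbitrary challenger does no better than a full extension of it. *)
apply/forall_inP => M' mM'; have [s' [t' sub]] := matching_extension mM'.
rewrite /AB_more_popular -gtz0_ge1 -leNgt.
apply: (@le_trans _ _ (\sum_(x : agent n | in_AB x)
    vote I x (perm_matching s' t') (perm_matching s t))%R).
  by apply: ler_sum => x hx; apply: vote_extension => //; apply: is_matching_perm.
by rewrite sumv -[X in (_ <= X)%R]addr0 lerD.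
Qed.

(** If [M] is not full, some agent of [A] is unmatched. It votes for a full extension, and nobody
    votes against. *)
Lemma AB_popular_full M : is_matching M -> AB_popular I M -> #|M| = n.
Proof.
move=> mM pop; have [s [t sub]] := matching_extension mM.
apply/eqP; rewrite eqn_leq card_matching // leqNgt; apply/negP => cM.
have [iA _ _] := matching_proj_inj mM.
have [a ha] : exists a, a \notin [set u.1.1 | u in M].
  apply/existsP; rewrite -negb_forall; apply: contraTN cM => /forallP all.
  rewrite -leqNgt -(card_in_imset iA) -[X in X <= _]card_ord -cardsT.
  by apply/subset_leq_card/subsetP => x _.
move/forall_inP: pop => /(_ _ (is_matching_perm s t)) /negP[].
rewrite /AB_more_popular (bigD1 (agA a)) //= -[X in (X <= _)%R]addr0.
apply: lerD.
  have -> : vote I (agA a) (perm_matching s t) M = 1%R => //.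
  have eM : partner M (agA a) = agA a.
    rewrite /partner /agA; case: pickP => // u /andP[uM /eqP e].
    by case/negP: ha; rewrite -e; apply: (imset_f (fun u : triple n => u.1.1)).
  by rewrite /vote /prefers eM index_pref_self // index_perm_partner.
apply: sumr_ge0 => x /andP[hx _].
apply: le_trans (vote_extension hx sub mM).
by rewrite /vote /prefers ltnn eqxx.
Qed.

Lemma AB_popular_permP s t : AB_popular I (perm_matching s t) <->
  envied_get_top (prefA I) s /\ envied_get_top (prefB I) t.
Proof.
rewrite AB_popular_perm; split=> -[hA hB]; split.
- exact: popular_envied_get_top (@prefA_uniq n I) hA.
- exact: popular_envied_get_top (@prefB_uniq n I) hB.
- exact: envied_get_top_popular.
- exact: envied_get_top_popular.
Qed.

End Matchings.

(** * Walks that evict occupants *)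

Section Walks.
Variables (n : nat) (o0 o1 : nat -> nat).
Hypothesis o0_lt : forall a, a < n -> o0 a < n.
Hypothesis o1_lt : forall a, a < n -> o1 a < n.

Definition allowed (a h : nat) : bool := (h == o0 a) || (h == o1 a).
Definition other (a h : nat) : nat := if o0 a == h then o1 a else o0 a.

(** A step of the walk with the occupants frozen. Free houses are fixed points, so [n] steps end in
    a free house exactly when the walk ever meets one. *)
Definition hop (who : nat -> nat) (h : nat) : nat :=
  if who h < n then other (who h) h else h.

Definition assign (who : nat -> nat) (h a : nat) : nat -> nat :=
  fun h' => if h' == h then a else who h'.

(* A house [h] with [n <= who h] is free. *)
Definition housed (A : nat -> Prop) (m : nat) (who : nat -> nat) : Prop :=
  [/\ forall h, h < n -> who h < n -> A (who h) /\ allowed (who h) h,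
      forall h h', h < n -> h' < n -> who h < n -> who h = who h' -> h = h' &
      count (fun h => who h < n) (iota 0 n) = m].

(** The housed agents while [m] is being inserted and [cur] is homeless. *)
Definition all_but (m cur a : nat) : Prop := a < m.+1 /\ a != cur.

(** A perfect matching in the graph that joins each agent to its two options. *)
Definition feasible : Prop := exists T : nat -> nat,
  (forall a, a < n -> allowed a (T a)) /\
  (forall a b, a < n -> b < n -> T a = T b -> a = b).

Lemma other_lt a h : a < n -> other a h < n.
Proof. by move=> ha; rewrite /other; case: ifP; rewrite ?o0_lt ?o1_lt. Qed.

Lemma allowed_lt a h : a < n -> allowed a h -> h < n.
Proof. by move=> ha /orP[] /eqP ->; rewrite ?o0_lt ?o1_lt. Qed.

Lemma allowed_other a h : allowed a (other a h).
Proof. by rewrite /allowed /other; case: ifP; rewrite eqxx ?orbT. Qed.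

Lemma allowed_cases a h h' : allowed a h -> allowed a h' -> h' = h \/ h' = other a h.
Proof.
rewrite /allowed /other => /orP[/eqP ->|/eqP ->] /orP[] /eqP ->; rewrite ?eqxx; auto.
by case: eqP => [->|_]; auto.
Qed.

Lemma hop_lt who h : h < n -> hop who h < n.
Proof. by move=> hh; rewrite /hop; case: ifP => // /other_lt. Qed.

Lemma iter_hop_lt who h k : h < n -> iter k (hop who) h < n.
Proof. by move=> hh; elim: k => //= k; apply: hop_lt. Qed.

Lemma housed_evict m who cur h : cur <= m -> m < n -> h < n -> who h < n ->
  allowed cur h -> housed (all_but m cur) m who ->
  housed (all_but m (who h)) m (assign who h cur).
Proof.
move=> hc hm hh hw opt [hA inj cnt]; split.
- move=> h' hh'; rewrite /assign /all_but; case: eqP => [-> _|ne w'].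
    by have [[_ /eqP ne] _] := hA _ hh hw; split=> //; split=> //; apply/eqP => /esym.
  have [[lt _] o] := hA _ hh' w'; split=> //; split=> //.
  by apply/eqP => /(inj _ _ hh' hh w').
- move=> h1 h2 l1 l2; rewrite /assign.
  case: eqP => [->|n1]; case: eqP => [->|n2] // w1 e.
  + by have := hA _ l2; rewrite -e => /(_ w1) [[_]]; rewrite eqxx.
  + by have := hA _ l1 w1; rewrite e => -[[_]]; rewrite eqxx.
  + exact: inj.
- rewrite -cnt; apply: eq_count => h'; rewrite /assign.
  by case: eqP => [->|//]; rewrite hw (leq_ltn_trans hc hm).
Qed.

Lemma housed_place m who cur h : cur <= m -> m < n -> h < n -> n <= who h ->
  allowed cur h -> housed (all_but m cur) m who ->
  housed (fun a => a < m.+1) m.+1 (assign who h cur).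
Proof.
move=> hc hm hh hw opt [hA inj cnt]; split.
- move=> h' hh'; rewrite /assign; case: eqP => [-> _|ne w']; first by split.
  by have [[lt _] o] := hA _ hh' w'.
- move=> h1 h2 l1 l2; rewrite /assign.
  case: eqP => [->|n1]; case: eqP => [->|n2] // w1 e.
  + by have := hA _ l2; rewrite -e => /(_ w1) [[_]]; rewrite eqxx.
  + by have := hA _ l1 w1; rewrite e => -[[_]]; rewrite eqxx.
  + exact: inj.
- pose A h' := who h' < n.
  have := count_predUI (pred1 h) A (iota 0 n).
  rewrite count_uniq_mem ?iota_uniq // mem_iota add0n hh /= cnt.
  have -> : count (predI (pred1 h) A) (iota 0 n) = 0.
    rewrite (eq_count (a2 := pred0)) ?count_pred0 // => x /=.
    by case: eqP => [->|//]; rewrite /A ltnNge hw.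
  rewrite addn0 add1n => <-; apply: eq_count => x /=; rewrite /assign /A.
  by case: eqP => [_|//]; rewrite (leq_ltn_trans hc hm).
Qed.

Lemma iter_hop_free who h i k : n <= who (iter i (hop who) h) -> i <= k ->
  iter k (hop who) h = iter i (hop who) h.
Proof.
move=> free /subnK <-; elim: (k - i) => //= j ->.
by rewrite /hop ltnNge free.
Qed.

Lemma iter_hop_looping who h : h < n -> looping (hop who) h n.
Proof.
move=> hh; apply: contraT; rewrite -looping_uniq => u.
suff : size (traject (hop who) h n.+1) <= size (iota 0 n).
  by rewrite size_traject size_iota ltnn.
apply: uniq_leq_size u _ => x /trajectP[i _ ->].
by rewrite mem_iota iter_hop_lt.
Qed.

(** Take the first free house on the walk. A repetition before it would be a shortcut to an earlier
    visit of that house. *)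
Lemma walk_to_free who h : h < n -> n <= who (iter n (hop who) h) ->
  exists2 d, d < n & n <= who (iter d (hop who) h) /\
    forall i j, i < j -> j <= d ->
      who (iter i (hop who) h) < n /\ iter i (hop who) h != iter j (hop who) h.
Proof.
move=> hh free.
have ex : exists d, n <= who (iter d (hop who) h) by exists n.
case: (ex_minnP ex) => d fd mind; exists d.
  (* By the pigeonhole principle the house reached after [n] steps was already visited at some step
     [i < n]. *)
  have /loopingP /(_ n) /trajectP[i hi e] := iter_hop_looping who hh.
  by apply: leq_ltn_trans hi; apply: mind; rewrite -e.
split=> // i j ij jd; split.
  by rewrite ltnNge; apply/negP => /mind; rewrite leqNgt (leq_trans ij jd).
apply/eqP => e; suff /mind : n <= who (iter (d - j + i) (hop who) h) by lia.
by rewrite iterD e -iterD subnK.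
Qed.

(* If both walks from the options of [m] never meet a free house, the visited
   houses violate Hall's condition: their occupants and [m] have all their
   options among them. *)
Lemma housed_stuck m who : m < n -> housed (fun a => a < m) m who ->
  who (iter n (hop who) (o0 m)) < n -> who (iter n (hop who) (o1 m)) < n ->
  ~ feasible.
Proof.
move=> hm [hA inj _] w0 w1 [T [optT injT]].
pose f := hop who.
pose R := undup (traject f (o0 m) n ++ traject f (o1 m) n).
have visit x : x \in R ->
    [/\ x < n, who x < n & f x \in R].
  rewrite mem_undup mem_cat => hx.
  have [h [hh wh hl hx' sub]] : exists h, [/\ h < n, who (iter n f h) < n,
      looping f h n, x \in traject f h n & {subset traject f h n <= R}].
    case/orP: hx => hx.
      exists (o0 m); split=> //; rewrite ?o0_lt ?iter_hop_looping ?o0_lt //.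
      by move=> y; rewrite mem_undup mem_cat => ->.
    exists (o1 m); split=> //; rewrite ?o1_lt ?iter_hop_looping ?o1_lt //.
    by move=> y; rewrite mem_undup mem_cat orbC => ->.
  case/trajectP: hx' => i hi ->; split; first exact: iter_hop_lt.
    (* A free house on the walk would be a fixed point, hence also the house reached after [n]
       steps. *)
    rewrite ltnNge; apply/negP => free.
    by move: wh; rewrite (iter_hop_free free (ltnW hi)) ltnNge free.
  by apply: sub; move/loopingP: hl => /(_ i.+1).
have start h : h \in [:: o0 m; o1 m] -> h \in R.
  have n0 : 0 < n by apply: leq_ltn_trans hm.
  rewrite !inE mem_undup mem_cat -(prednK n0) !trajectS => /orP[] /eqP ->.
    by rewrite mem_head.
  by rewrite mem_head orbT.
pose A := m :: [seq who h | h <- R].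
have ltA a : a \in A -> a < n.
  rewrite inE => /orP[/eqP -> //|/mapP[h /visit[_ w _] ->]] //.
have uA : uniq A.
  rewrite /= map_inj_in_uniq ?undup_uniq ?andbT.
    apply/mapP => -[h /visit[lt w _] e].
    by have [] := hA h lt w; rewrite -e ltnn.
  by move=> h h' /visit[l1 w _] /visit[l2 _ _]; apply: inj.
have sTA : {subset [seq T a | a <- A] <= R}.
  move=> _ /mapP[a aA ->]; have := optT a (ltA _ aA).
  move: aA; rewrite inE => /orP[/eqP -> o|/mapP[h hR -> o]].
    by apply: start; rewrite !inE.
  have [lt w fR] := visit h hR; have [_ o'] := hA h lt w.
  case: (allowed_cases o' o) => -> //.
  by move: fR; rewrite /f /hop w.
have uTA : uniq [seq T a | a <- A].
  by rewrite map_inj_in_uniq // => a b /ltA ha /ltA hb; apply: injT.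
by have := uniq_leq_size uTA sTA; rewrite size_map /= size_map ltnn.
Qed.

Lemma housed_all who : housed (fun a => a < n) n who ->
  forall h, h < n -> who h < n.
Proof.
case=> _ _ cnt h hh.
have : all (fun h => who h < n) (iota 0 n) by rewrite all_count cnt size_iota.
by move/allP; apply; rewrite mem_iota.
Qed.

End Walks.

(** * The test for envy *)

Definition setv (x : nat) (e : expr) : prog := Do x (Const 0) e.

Definition seen (L : nat -> nat -> nat) (w : nat -> nat) (a j : nat) : bool :=
  has (fun i => w (L a i) == a) (iota 0 j).

(** The prefix has length [j.+1] so that the house of [a] itself passes too; only houses listed
    strictly before it are envied. *)
Definition step_ok (L : nat -> nat -> nat) (w : nat -> nat) (a j : nat) : bool :=
  seen L w a j.+1 || (L (w (L a j)) 0 == L a j).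

Definition envy_check n (L : nat -> nat -> nat) (w : nat -> nat) (m : nat) : bool :=
  all (fun a => all (step_ok L w a) (iota 0 n)) (iota 0 m).

(* Cells: 11 agent, 12 position in its list, 13 whether its own house was already
   passed, 14 house, 6 answer. Array V maps each house to its agent. *)
Section Check.
Variables P V : nat.

Definition check_step : prog :=
  Then (setv 14 (Get P (Add (Mul (var 11) (var 0)) (var 12))))
  (Cond (Eq (Get V (var 14)) (var 11)) (setv 13 (Const 1))
  (Cond (var 13) Nop
  (Cond (Eq (Get P (Mul (Get V (var 14)) (var 0))) (var 14)) Nop
    (setv 6 (Const 0))))).

Definition check : prog :=
  For 11 (Then (setv 13 (Const 0)) (For 12 check_step)).

Hypothesis HP : P \notin [:: 6; 11; 12; 13; 14].
Hypothesis HV : V \notin [:: 6; 11; 12; 13; 14].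

Lemma den_check_step s (h := s P (s 11 0 * s 0 0 + s 12 0)) :
  den check_step s 13 0 = (if s V h == s 11 0 then 1 else s 13 0) /\
  den check_step s 6 0 =
    (if [|| s V h == s 11 0, s 13 0 != 0 | s P (s V h * s 0 0) == h] then s 6 0 else 0).
Proof.
have [P14 V14] : (P == 14) = false /\ (V == 14) = false.
  by move: HP HV; rewrite !inE !negb_or => /and5P[_ _ _ _ /negbTE ->] /and5P[_ _ _ _ /negbTE ->].
rewrite /check_step /= /update /= !P14 !V14 /= -/h.
have [e|e] := eqVneq (s V h) (s 11 0); first by [].
have [e'|e'] := eqVneq (s 13 0) 0 => //=.
have [e2|e2] := eqVneq (s P (s V h * s 0 0)) h => //=.
Qed.

(** The answer cell is only ever reset to 0. The product records this, so two checks in succession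
    compute a conjunction. *)
Lemma den_check s n L w : s 0 0 = n ->
  (forall a j, a < n -> j < n -> s P (a * n + j) = L a j) ->
  (forall a j, a < n -> j < n -> L a j < n) ->
  (forall h, h < n -> s V h = w h) -> (forall h, h < n -> w h < n) ->
  den check s 6 0 = s 6 0 * envy_check n L w n.
Proof.
move=> sn sP Ln sV wn.
have fP : P \notin [:: 11; 13; 12; 14; 13; 6] /\ P \notin [:: 12; 14; 13; 6].
  by move: HP; rewrite !inE; lia.
have fV : V \notin [:: 11; 13; 12; 14; 13; 6] /\ V \notin [:: 12; 14; 13; 6].
  by move: HV; rewrite !inE; lia.
have nP : (P == 13) = false by move: HP; rewrite !inE; lia.
have nV : (V == 13) = false by move: HV; rewrite !inE; lia.
apply: (@den_for (fun i s' => s' 6 0 = s 6 0 * envy_check n L w i)) => //.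
  by rewrite /update /= muln1.
move=> i s1 hi xi fr Ii.
change (den (For 12 check_step) (update s1 13 0 0) 6 0 = s 6 0 * envy_check n L w i.+1).
set s2 := update s1 13 0 0.
have s2n : s2 0 0 = n by rewrite /s2 /update /= fr.
suff [-> _] : den (For 12 check_step) s2 6 0 = s1 6 0 * all (step_ok L w i) (iota 0 n)
    /\ den (For 12 check_step) s2 13 0 = seen L w i n.
  by rewrite Ii /envy_check -[i.+1]addn1 iotaD all_cat /= andbT add0n -mulnA mulnb.
apply: (@den_for (fun j s' => s' 6 0 = s1 6 0 * all (step_ok L w i) (iota 0 j)
    /\ s' 13 0 = seen L w i j)) => //.
  by rewrite /update /= muln1.
move=> j s3 hj xj fr3 [I6 I13].
have s30 : s3 0 0 = n by rewrite fr3.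
have s3x : s3 11 0 = i by rewrite fr3.
have s3P k : s3 P k = s P k.
  by rewrite fr3 ?fP.2 // /s2 /update nP /= fr ?fP.1.
have s3V k : s3 V k = s V k.
  by rewrite fr3 ?fV.2 // /s2 /update nV /= fr ?fV.1.
have [e13 e6] := den_check_step s3.
have n0 : 0 < n by apply: leq_ltn_trans hi.
have Lij := Ln _ _ hi hj.
have seenS : seen L w i j.+1 = seen L w i j || (w (L i j) == i).
  by rewrite /seen -[j.+1]addn1 iotaD has_cat /= orbF.
change (den check_step s3 6 0 = s1 6 0 * all (step_ok L w i) (iota 0 j.+1)
  /\ den check_step s3 13 0 = seen L w i j.+1).
rewrite e13 e6.
rewrite s30 s3x xj !s3P !s3V sP // !sV // -[w _ * n]addn0 sP ?wn // I13 I6.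
have -> : all (step_ok L w i) (iota 0 j.+1)
    = all (step_ok L w i) (iota 0 j) && step_ok L w i j.
  by rewrite -[j.+1]addn1 iotaD all_cat /= andbT.
rewrite {3}/step_ok seenS.
by case: (seen L w i j); case: (w (L i j) == i);
  case: (L (w (L i j)) 0 == L i j); rewrite /= ?andbT ?andbF ?muln0.
Qed.
End Check.

(** * The two options of each agent *)

Definition is_top n (L : nat -> nat -> nat) (h : nat) : bool :=
  has (fun b => L b 0 == h) (iota 0 n).

Definition best_non_top n (L : nat -> nat -> nat) (a h : nat) : Prop :=
  exists k, [/\ k < n, h = L a k, ~~ is_top n L h & forall i, i < k -> is_top n L (L a i)].

(** If every house is somebody's top choice, the two options of [a] coincide. *)
Definition second_option n (L : nat -> nat -> nat) (a h : nat) : Prop :=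
  best_non_top n L a h \/ (h = L a 0 /\ forall i, i < n -> is_top n L (L a i)).

Lemma iota0S i : iota 0 i.+1 = iota 0 i ++ [:: i].
Proof. by rewrite -[i.+1]addn1 iotaD. Qed.

(* Arrays: 20 first option, 21 second option, 22 whether a house is a top choice,
   23 occupant of a house, [n] if free. *)
Section Options.
Variable P : nat.

Definition clear : prog :=
  For 24 (Then (Do 22 (var 24) (Const 0)) (Do 23 (var 24) (var 0))).

Definition firsts : prog :=
  For 24 (Then (Do 20 (var 24) (Get P (Mul (var 24) (var 0))))
               (Do 22 (Get 20 (var 24)) (Const 1))).

(** The candidate is overwritten only while it is a top choice, so the first house of the list that
    is nobody's top choice survives. *)
Definition second_step : prog :=
  Cond (Get 22 (Get 21 (var 24)))
    (Do 21 (var 24) (Get P (Add (Mul (var 24) (var 0)) (var 25)))) Nop.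

Definition seconds : prog :=
  For 24 (Then (Do 21 (var 24) (Get 20 (var 24)))
         (Then (For 25 second_step)
               (Cond (Get 22 (Get 21 (var 24)))
                  (Do 21 (var 24) (Get 20 (var 24))) Nop))).

Hypothesis HP : P < 10.

Variables (n : nat) (L : nat -> nat -> nat).
Hypothesis L_lt : forall a j, a < n -> j < n -> L a j < n.

Definition reads (s : state) : Prop :=
  s 0 0 = n /\ forall a j, a < n -> j < n -> s P (a * n + j) = L a j.

(** The preference arrays have numbers below 10; writing only arrays from 10 on leaves them
    alone. *)
Lemma reads_frame s s' ws : all (fun y => 10 <= y) ws ->
  (forall y, y \notin ws -> s' y = s y) -> reads s -> reads s'.
Proof.
move=> hp fr [sn sP]; have nw y : y < 10 -> y \notin ws.
  by move=> hy; apply: contraTN hy => /(allP hp); rewrite -leqNgt.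
by split=> [|a j ha hj]; rewrite fr ?nw //; apply: sP.
Qed.

Lemma reads_den s p : all (fun y => 10 <= y) (writes p) -> reads s -> reads (den p s).
Proof. by move=> hp; apply: (reads_frame hp) => y; apply: den_frame. Qed.

Lemma den_clear s : reads s ->
  forall h, h < n -> den clear s 22 h = 0 /\ den clear s 23 h = n.
Proof.
move=> [sn _].
apply: (@den_for (fun i s' => forall h, h < i -> s' 22 h = 0 /\ s' 23 h = n)) => //.
move=> i s1 hi xi fr Ii h; rewrite ltnS leq_eqVlt.
have s1n : s1 0 0 = n by rewrite fr.
rewrite /update /= /update /= xi s1n.
by case: eqP => //= _ /Ii.
Qed.

Definition tops_set (s : state) : Prop :=
  (forall a, a < n -> s 20 a = L a 0) /\
  (forall h, h < n -> (s 22 h != 0) = is_top n L h).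

Lemma den_firsts s : reads s -> (forall h, h < n -> s 22 h = 0) ->
  tops_set (den firsts s).
Proof.
move=> rs s22.
apply: (@den_for (fun i s' => (forall a, a < i -> s' 20 a = L a 0) /\
   (forall h, h < n -> (s' 22 h != 0) = has (fun b => L b 0 == h) (iota 0 i)))).
- exact: rs.1.
- by [].
- by [].
- by split=> // h /s22; rewrite /update /= => ->.
move=> i s1 hi xi fr [I20 I22].
have [s1n s1P] : reads s1 by apply: reads_frame fr rs.
have n0 : 0 < n by apply: leq_ltn_trans hi.
have P20 : (P == 20) = false by lia.
have Li : s1 P (i * n) = L i 0 by rewrite -[i * n]addn0 s1P.
split=> [a|h hh].
  rewrite /update /= /update /= ?eqxx xi s1n Li.
  by rewrite ltnS leq_eqVlt; case: eqP => [->|_] //= /I20.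
rewrite iota0S has_cat /update /= /update /= ?eqxx xi s1n Li orbF [h == _]eq_sym.
by case: (L i 0 == h); rewrite ?orbT ?orbF //= -I22.
Qed.

Lemma is_top_first a : a < n -> is_top n L (L a 0).
Proof. by move=> ha; apply/hasP; exists a; rewrite ?mem_iota. Qed.

Lemma den_seconds s : reads s -> tops_set s ->
  forall a, a < n -> second_option n L a (den seconds s 21 a).
Proof.
move=> rs [s20 s22].
apply: (@den_for (fun i s' => forall a, a < i -> second_option n L a (s' 21 a))) => //.
  exact: rs.1.
move=> i s1 hi xi fr Ii.
have rs1 : reads s1 by apply: reads_frame fr rs.
have n0 : 0 < n by apply: leq_ltn_trans hi.
set s2 := update s1 21 i (s1 20 i).
set s3 := den (For 25 second_step) s2.
have -> : den (Then (Do 21 (var 24) (Get 20 (var 24)))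
         (Then (For 25 second_step)
               (Cond (Get 22 (Get 21 (var 24)))
                  (Do 21 (var 24) (Get 20 (var 24))) Nop))) s1 =
  den (Cond (Get 22 (Get 21 (var 24))) (Do 21 (var 24) (Get 20 (var 24))) Nop) s3.
  by rewrite /s3 /s2 -xi.
have rs2 : reads s2.
  by apply: (@reads_frame s1 s2 [:: 21]) => // y; rewrite inE; apply: update_frame.
(* After the scan, either the candidate is final or it is still a top choice and the whole list
   consists of top choices. *)
have [old new] : (forall a, a < i -> second_option n L a (s3 21 a)) /\
  (best_non_top n L i (s3 21 i) \/
   [/\ is_top n L (s3 21 i), s3 21 i < n & forall m, m < n -> is_top n L (L i m)]).
  apply: (@den_for (fun j s' => (forall a, a < i -> second_option n L a (s' 21 a)) /\
    (best_non_top n L i (s' 21 i) \/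
     [/\ is_top n L (s' 21 i), s' 21 i < n & forall m, m < j -> is_top n L (L i m)]))).
  - exact: rs2.1.
  - by [].
  - by [].
  - rewrite /s2 /update /= eqxx fr // s20 //; split=> [a ha|].
      by rewrite ltn_eqF //; apply: Ii.
    by right; rewrite is_top_first ?L_lt.
  move=> j s4 hj xj fr4 [I4 J4].
  have [s4n s4P] : reads s4 by apply: reads_frame fr4 rs2.
  have s4x : s4 24 0 = i by rewrite fr4 // /s2 /update /= xi.
  have s422 h : h < n -> (s4 22 h != 0) = is_top n L h.
    by move=> hh; rewrite fr4 // /s2 /update /= fr // s22.
  change ((forall a, a < i -> second_option n L a (den second_step s4 21 a)) /\
    (best_non_top n L i (den second_step s4 21 i) \/
     [/\ is_top n L (den second_step s4 21 i), den second_step s4 21 i < n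
       & forall m, m < j.+1 -> is_top n L (L i m)])).
  have e21 : den second_step s4 21 = if s4 22 (s4 21 i) != 0
      then assign (s4 21) i (L i j) else s4 21.
    rewrite /= s4x s4n xj s4P //; case: ifP => // _.
  rewrite e21; case: J4 => [best|[t lt all]].
    have [k [hk e nt _]] := best.
    rewrite s422 ?(negbTE nt); last by rewrite e L_lt.
    by split=> //; left.
  rewrite s422 // t /assign eqxx; split=> [a ha|].
    by rewrite ltn_eqF //; apply: I4.
  have [tj|ntj] := boolP (is_top n L (L i j)).
    right; split=> //; first exact: L_lt.
    by move=> m; rewrite ltnS leq_eqVlt => /predU1P[->|/all].
  by left; exists j.
have s3x : s3 24 0 = i by rewrite /s3 den_frame // /s2 /update /= xi.
have s320 : s3 20 i = L i 0 by rewrite /s3 den_frame // /s2 /update /= fr // s20.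
have s322 h : h < n -> (s3 22 h != 0) = is_top n L h.
  by move=> hh; rewrite /s3 den_frame // /s2 /update /= fr // s22.
set s5 := den _ s3.
have e21 : s5 21 = if s3 22 (s3 21 i) != 0 then assign (s3 21) i (L i 0) else s3 21.
  by rewrite /s5 /= s3x s320; case: ifP.
move=> a; change (a < i.+1 -> second_option n L a (s5 21 a)).
rewrite e21 ltnS leq_eqVlt; case: new => [best|[t lt all]].
  have [k [hk e nt _]] := best.
  rewrite s322 ?(negbTE nt) /=; last by rewrite e L_lt.
  by move=> /predU1P[->|/old //]; left.
rewrite s322 // t /assign; case: eqP => [-> _|_ /old //].
by right.
Qed.
End Options.

(** * Placing the agents *)

(* Cells: 24 agent to be placed, 26 start and 27 current house of a walk,
   28 agent without a house, 30 whether the insertion is over, 31 failure. *)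
Section Placement.

Definition walk_step : prog :=
  Cond (Lt (Get 23 (var 27)) (var 0))
    (Cond (Eq (Get 20 (Get 23 (var 27))) (var 27))
      (setv 27 (Get 21 (Get 23 (var 27))))
      (setv 27 (Get 20 (Get 23 (var 27)))))
    Nop.

Definition walk : prog := For 25 walk_step.

Definition evict_step : prog :=
  Cond (var 30) Nop
  (Cond (Lt (Get 23 (var 27)) (var 0))
    (Then (setv 29 (Get 23 (var 27)))
    (Then (Do 23 (var 27) (var 28))
    (Then (setv 28 (var 29))
      (Cond (Eq (Get 20 (var 28)) (var 27))
        (setv 27 (Get 21 (var 28)))
        (setv 27 (Get 20 (var 28)))))))
    (Then (Do 23 (var 27) (var 28)) (setv 30 (Const 1)))).

Definition evict : prog := For 25 evict_step.

Definition walk_from (x : nat) : prog :=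
  Then (setv 26 (Get x (var 24))) (Then (setv 27 (var 26)) walk).

Definition occupied : expr := Lt (Get 23 (var 27)) (var 0).

Definition insert : prog :=
  Then (setv 27 (var 26)) (Then (setv 28 (var 24)) (Then (setv 30 (Const 0)) evict)).

(** A dry run that moves nobody. Unless cell 27 ends in an occupied house, cell 26 holds a start
    from which the evictions will succeed. *)
Definition choose_walk : prog := Then (walk_from 20) (Cond occupied (walk_from 21) Nop).

Definition place_step : prog :=
  Then choose_walk (Cond occupied (setv 31 (Const 1)) insert).

Definition place : prog := For 24 place_step.

Variables (n : nat) (o0 o1 : nat -> nat).
Hypothesis o0_lt : forall a, a < n -> o0 a < n.
Hypothesis o1_lt : forall a, a < n -> o1 a < n.

Definition setting (s : state) : Prop := [/\ s 0 0 = n, s 20 = o0 & s 21 = o1].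

Lemma setting_frame s s' : s' 0 = s 0 -> s' 20 = s 20 -> s' 21 = s 21 ->
  setting s -> setting s'.
Proof. by rewrite /setting => -> -> ->. Qed.

Lemma den_walk s : setting s ->
  den walk s 27 0 = iter n (hop n o0 o1 (s 23)) (s 27 0).
Proof.
move=> st; apply: (@den_for (fun j s' => s' 27 0 = iter j (hop n o0 o1 (s 23)) (s 27 0))) => //.
  by case: st.
move=> j s1 hj xj fr Ij.
have [sn s20 s21] : setting s1 by apply: setting_frame st; apply: fr.
have s23 : s1 23 = s 23 by apply: fr.
rewrite iterS -Ij /hop /other -s20 -s21 -s23 -sn /update /=.
by case: (s1 23 (s1 27 0) < s1 0 0) => //=; case: (s1 20 _ == s1 27 0).
Qed.

(** The evictions follow the walk computed with the old occupants: its houses are distinct up to the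
    first free one, so each still has its old occupant when reached. Step [d] fills the free house,
    and the remaining iterations do nothing. *)
Lemma den_evict s m : setting s -> s 30 0 = 0 -> s 28 0 = m -> m < n ->
  allowed o0 o1 m (s 27 0) -> housed n o0 o1 (fun a => a < m) m (s 23) ->
  n <= s 23 (iter n (hop n o0 o1 (s 23)) (s 27 0)) ->
  housed n o0 o1 (fun a => a < m.+1) m.+1 (den evict s 23).
Proof.
move=> st s30 s28 hm al hs free.
set who := s 23 in hs free *; set h0 := s 27 0 in al free *.
have hh0 : h0 < n by apply: (allowed_lt o0_lt o1_lt hm al).
have [d hd [fd dist]] := walk_to_free o0_lt o1_lt hh0 free.
set f := hop n o0 o1 who in free fd dist.
pose running j (s' : state) := [/\ s' 30 0 = 0, s' 27 0 = iter j f h0, s' 28 0 <= m,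
  allowed o0 o1 (s' 28 0) (s' 27 0) &
  housed n o0 o1 (all_but m (s' 28 0)) m (s' 23) /\
  forall h, h \notin traject f h0 j -> s' 23 h = who h].
pose finished (s' : state) :=
  s' 30 0 != 0 /\ housed n o0 o1 (fun a => a < m.+1) m.+1 (s' 23).
suff [_ fin] : (n <= d -> running n (den evict s)) /\ (d < n -> finished (den evict s)).
  by case: (fin hd).
apply: (@den_for (fun j s' => (j <= d -> running j s') /\ (d < j -> finished s'))) => //.
- by case: st.
(* Initially [m] itself is homeless, and [all_but m m] comprises the agents below [m]. *)
- split=> // _; rewrite /running /update /= s30 s28; split=> //; split=> //.
  case: hs => hA inj cnt; split=> // h hh hw.
  by have [lt o] := hA h hh hw; split=> //; split; [apply: ltnW|rewrite ltn_eqF].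
move=> j s1 hj xj fr [run fin].
have [sn s20 s21] : setting s1 by apply: setting_frame st; apply: fr.
change ((j < d -> running j.+1 (den evict_step s1)) /\
        (d < j.+1 -> finished (den evict_step s1))).
have [jd|dj] := leqP j d; last first.
  split=> [jd|_]; first by lia.
  have [d1 hh] := fin dj.
  by rewrite /finished /evict_step /= d1.
have [r30 r27 r28 ral [rh rw]] := run jd.
set h := s1 27 0 in r27 ral *; set cur := s1 28 0 in r28 ral rh.
have hh : h < n by rewrite r27 iter_hop_lt.
have hw : s1 23 h = who h.
  apply: rw; rewrite r27; apply/trajectP => -[i ij e].
  by have [_] := dist i j ij jd; rewrite e eqxx.
split=> [ltjd|].
  have [occ _] := dist j d ltjd (leqnn _); rewrite -r27 -hw in occ.
  have cur2 : who h < n by rewrite -hw.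
  have e23 : den evict_step s1 23 = assign (s1 23) h cur.
    by rewrite /evict_step /= r30 /= sn occ /=; case: ifP.
  have e28 : den evict_step s1 28 0 = s1 23 h.
    by rewrite /evict_step /= r30 /= sn occ /=; case: ifP.
  have e30 : den evict_step s1 30 0 = 0.
    by rewrite /evict_step /= r30 /= sn occ /=; case: ifP.
  have e27 : den evict_step s1 27 0 = other o0 o1 (s1 23 h) h.
    rewrite /evict_step /= r30 /= sn occ /= /other -s20 -s21 /update /=.
    by rewrite -/h; case: (s1 20 (s1 23 h) == h).
  rewrite /running e23 e28 e30 e27.
  have [inA _ _] := rh; have [[lt _] _] := inA h hh occ.
  split=> //.
  - by rewrite iterS -r27 /f /hop cur2 hw.
  - exact: allowed_other.
  split; first by apply: housed_evict.
  move=> h'; rewrite trajectSr mem_rcons inE negb_or -r27 => /andP[ne nt].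
  by rewrite /assign (negbTE ne) rw.
rewrite ltnS => dj; have ej : j = d by apply/eqP; rewrite eqn_leq jd.
have occ : n <= s1 23 h by rewrite hw r27 ej.
have occF : (s1 23 h < n) = false by apply/negbTE; rewrite -leqNgt.
have e23 : den evict_step s1 23 = assign (s1 23) h cur.
  by rewrite /evict_step /= r30 /= sn occF.
have e30 : den evict_step s1 30 0 != 0.
  by rewrite /evict_step /= r30 /= sn occF.
by split=> //; rewrite e23; apply: housed_place.
Qed.

Lemma den_walk_from s x : setting s ->
  den (walk_from x) s 26 0 = s x (s 24 0) /\
  den (walk_from x) s 27 0 = iter n (hop n o0 o1 (s 23)) (s x (s 24 0)).
Proof.
move=> st.
set s' := update (update s 26 0 (s x (s 24 0))) 27 0 (s x (s 24 0)).
change (den walk s' 26 0 = s' 26 0 /\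
  den walk s' 27 0 = iter n (hop n o0 o1 (s' 23)) (s' 27 0)).
by rewrite den_walk // den_frame.
Qed.

(** Infeasibility does not depend on the state, so after a failure the later iterations only have to
    leave the flag nonzero. *)
Lemma den_place s : setting s -> s 31 0 = 0 -> (forall h, h < n -> s 23 h = n) ->
  (den place s 31 0 = 0 /\ housed n o0 o1 (fun a => a < n) n (den place s 23)) \/
  (den place s 31 0 != 0 /\ ~ feasible n o0 o1).
Proof.
move=> st s31 s23.
apply: (@den_for (fun i s' =>
  (s' 31 0 = 0 /\ housed n o0 o1 (fun a => a < i) i (s' 23)) \/
  (s' 31 0 != 0 /\ ~ feasible n o0 o1))) => //.
- by case: st.
- left; split=> //; split=> [h hh|h h' hh hh'|]; rewrite /update /=.
  + by rewrite s23 // ltnn.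
  + by rewrite s23 // ltnn.
  + rewrite (eq_in_count (a2 := pred0)) ?count_pred0 // => h.
    by rewrite mem_iota => /andP[_ hh]; rewrite s23 // ltnn.
move=> i s1 hi xi fr Ii.
have st1 : setting s1 by apply: setting_frame st; apply: fr.
change ((den place_step s1 31 0 = 0 /\
    housed n o0 o1 (fun a => a < i.+1) i.+1 (den place_step s1 23)) \/
  (den place_step s1 31 0 != 0 /\ ~ feasible n o0 o1)).
case: Ii => [[I31 hs]|[I31 inf]]; last first.
  right; split=> //; rewrite /place_step.
  change ((if ev (den choose_walk s1) occupied != 0
    then den (setv 31 (Const 1)) (den choose_walk s1)
    else den insert (den choose_walk s1)) 31 0 != 0).
  by case: ifP => // _; rewrite !den_frame.
set s2 := den (walk_from 20) s1.
have [n1 s120 s121] := st1.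
have [w26 w27] := den_walk_from 20 st1; rewrite -/s2 xi s120 in w26 w27.
have st2 : setting s2 by apply: setting_frame st1; apply: den_frame.
set s3 := den choose_walk s1.
have s323 : s3 23 = s1 23 by apply: den_frame.
have st3 : setting s3 by apply: setting_frame st1; apply: den_frame.
have s224 : s2 24 0 = i by rewrite /s2 den_frame.
have s223 : s2 23 = s1 23 by apply: den_frame.
have evo s' : setting s' -> ev s' occupied != 0 = (s' 23 (s' 27 0) < n).
  by case=> e _ _; rewrite /= e; case: (_ < _).
have e3 : s3 = if s2 23 (s2 27 0) < n then den (walk_from 21) s2 else s2.
  by rewrite -evo.
set hopi := iter n (hop n o0 o1 (s1 23)) in w27 *.
(* The second walk is taken only if the first one ended in an occupied house, so an occupied end
   means that both walks fail. *)
have [al s327 bad] : [/\ allowed o0 o1 i (s3 26 0), s3 27 0 = hopi (s3 26 0) &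
    s1 23 (s3 27 0) < n -> s1 23 (hopi (o0 i)) < n /\ s1 23 (hopi (o1 i)) < n].
  rewrite e3; case: ifP => occ; last first.
    rewrite w26 w27 /allowed eqxx; split=> //.
    by rewrite -w27 -s223 occ.
  have [v26 v27] := den_walk_from 21 st2.
  have [_ _ s221] := st2; rewrite s224 s221 s223 in v26 v27.
  rewrite v26 v27 /allowed eqxx orbT; split=> // h.
  by rewrite -w27 -{1}s223.
have -> : den place_step s1 =
    if s3 23 (s3 27 0) < n then update s3 31 0 1 else den insert s3.
  by rewrite -evo.
rewrite s323; case: ifP => occ.
  have [b0 b1] := bad occ; right; split=> //.
  exact: housed_stuck b0 b1.
left; split; first by rewrite den_frame // /s3 den_frame.
set s4 := update (update (update s3 27 0 (s3 26 0)) 28 0 (s3 24 0)) 30 0 0.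
rewrite [den insert s3](_ : _ = den evict s4) //.
apply: den_evict => //.
- by rewrite /s4 /update /= /s3 den_frame.
- by rewrite /s4 update_frame // update_frame // update_frame // s323.
rewrite [s4 23](_ : _ = s1 23); last first.
  by rewrite /s4 update_frame // update_frame // update_frame // s323.
by rewrite leqNgt -[s4 27 0]/(s3 26 0) -/(hopi _) -s327 occ.
Qed.
End Placement.

(** * Correctness of the programs *)

Lemma nth_flatten_blocks (T : Type) (x0 : T) m (ss : seq (seq T)) i j :
  all (fun b => size b == m) ss -> i < size ss -> j < m ->
  nth x0 (flatten ss) (i * m + j) = nth x0 (nth [::] ss i) j.
Proof.
elim: ss i => //= b ss IH [|i] /andP[/eqP sb hs] hi hj; rewrite nth_cat sb.
  by rewrite mul0n hj.
by rewrite mulSn -addnA ltnNge leq_addr /= addnC addnK IH.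
Qed.

(** * Stored preference lists and bijections *)

Section Preferences.
Variables (n : nat) (l : 'I_n -> n.-tuple 'I_n).
Hypothesis l_uniq : forall a, uniq (l a).

Definition entry (a j : nat) : nat := nth 0 (encode_prefs l) (a * n + j).

Lemma entryE (a j : 'I_n) : entry a j = tnth (l a) j.
Proof.
rewrite /entry /encode_prefs nth_flatten_blocks //; last by rewrite size_map -cardE card_ord.
  rewrite (nth_map a) -?cardE ?card_ord // nth_ord_enum.
  by rewrite (nth_map j) ?size_tuple // (tnth_nth j).
by apply/allP => _ /mapP[x _ ->]; rewrite size_map size_tuple.
Qed.

Lemma entry_lt a j : a < n -> j < n -> entry a j < n.
Proof. by move=> ha hj; rewrite (entryE (Ordinal ha) (Ordinal hj)). Qed.

Lemma rank_lt a y : rank (l a) y < n.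
Proof. by rewrite -[X in _ < X](size_tuple (l a)) index_mem mem_pref. Qed.

Lemma entry_rank (a y : 'I_n) : entry a (rank (l a) y) = y.
Proof.
by rewrite (entryE a (Ordinal (rank_lt a y))) (tnth_nth y) nth_index ?mem_pref.
Qed.

Lemma rank_entry (a y : 'I_n) k : k < n -> entry a k = y -> rank (l a) y = k.
Proof.
move=> hk; rewrite (entryE a (Ordinal hk)) => /val_inj <-.
by rewrite (tnth_nth y) /rank index_uniq ?size_tuple.
Qed.

Lemma rank_inj a : injective (rank (l a)).
Proof. by move=> y z e; apply: val_inj; rewrite /= -(entry_rank a) e entry_rank. Qed.

Lemma is_topP (y : 'I_n) : reflect (exists b, rank (l b) y = 0) (is_top n entry y).
Proof.
have n0 : 0 < n by apply: leq_ltn_trans (ltn_ord y).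
apply: (iffP hasP) => [[b]|[b e]].
  rewrite mem_iota /= => hb /eqP e; exists (Ordinal hb); exact: (@rank_entry (Ordinal hb) _ _ n0 e).
by exists (val b); [rewrite mem_iota /= | rewrite -e entry_rank].
Qed.

(** The scan of the list of [p] meets the house of an envied [q] before that of [p], when only the
    top-choice test can succeed. *)
Lemma envy_checkP (s : {perm 'I_n}) (w : nat -> nat) : (forall h : 'I_n, w h = (s^-1)%g h :> nat) ->
  envy_check n entry w n <-> envied_get_top l s.
Proof.
move=> ws; split=> [/allP ok p q hpq|env].
  have := ok p; rewrite mem_iota /= => /(_ (ltn_ord p)) /allP.
  move=> /(_ (rank (l p) (s q))); rewrite mem_iota rank_lt => /(_ isT).
  rewrite /step_ok entry_rank ws permK => /orP[/hasP[i]|/eqP e]; last first.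
    by apply: rank_entry => //; apply: leq_ltn_trans (ltn_ord p).
  rewrite mem_iota ltnS => /andP[_ hi].
  have hin : i < n by apply: leq_ltn_trans hi (rank_lt _ _).
  rewrite (entryE p (Ordinal hin)) ws => /eqP /val_inj e.
  have : rank (l p) (s p) = i.
    apply: rank_entry => //; rewrite (entryE p (Ordinal hin)).
    by rewrite -[in RHS]e permKV.
  by move=> e2; move: hpq; rewrite e2 ltnNge hi.
apply/allP => a; rewrite mem_iota /= => ha; apply/allP => j; rewrite mem_iota /= => hj.
rewrite /step_ok -implyNb; apply/implyP => /hasPn ns.
pose p := Ordinal ha; pose y := tnth (l p) (Ordinal hj).
have ey : entry a j = y by rewrite (entryE p (Ordinal hj)).
have ry : rank (l p) y = j by apply: rank_entry.
rewrite ey ws; set q := (s^-1)%g y.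
have sq : s q = y by rewrite /q permKV.
have lt : rank (l p) (s q) < rank (l p) (s p).
  rewrite sq ry ltnNge; apply/negP => le.
  have := ns (rank (l p) (s p)); rewrite mem_iota /= ltnS le => /(_ isT).
  by rewrite (entry_rank p) ws permK eqxx.
by rewrite -sq -{1}(env _ _ lt) entry_rank.
Qed.

Variables (o0 o1 : nat -> nat).
Hypothesis o0E : forall a, a < n -> o0 a = entry a 0.
Hypothesis o1E : forall a, a < n -> second_option n entry a (o1 a).

(** From left to right, [p] prefers only top-choice houses to its own, so an envied house is a top
    choice of somebody and cannot be a second option distinct from the holder's top. Conversely, if
    [a] misses its top, its house is nobody's top, or that agent would envy [a]; and every house [a]
    prefers is the top of its holder. *)
Lemma allowed_envied (s : {perm 'I_n}) :
  (forall a : 'I_n, allowed o0 o1 a (s a)) <-> envied_get_top l s.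
Proof.
split=> [al p q hpq|env a].
  have n0 : 0 < n by apply: leq_ltn_trans (ltn_ord p).
  have nt x : rank (l x) (s x) != 0 -> best_non_top n entry x (s x).
    move=> hx; have tx : o0 x <> s x.
      by move=> e; case/negP: hx; apply/eqP/rank_entry => //; rewrite -o0E.
    case/orP: (al x) => /eqP e; first by case: tx.
    case: (o1E (ltn_ord x)) => [|[e' _]]; first by rewrite e.
    by case: tx; rewrite e e' o0E.
  apply/eqP; apply: contraT => /nt [_ [_ _ /negP[]]].
  have hp : rank (l p) (s p) != 0 by rewrite -lt0n (leq_ltn_trans _ hpq).
  have [k [hk e _ top]] := nt p hp.
  rewrite -(entry_rank p (s q)); apply: top.
  by rewrite -(rank_entry hk (esym e)).
have n0 : 0 < n by apply: leq_ltn_trans (ltn_ord a).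
rewrite /allowed o0E //; have [r0|r0] := eqVneq (rank (l a) (s a)) 0.
  by rewrite -r0 entry_rank eqxx.
apply/orP; right; apply/eqP.
have nt : ~~ is_top n entry (s a).
  apply/is_topP => -[b hb]; case/negP: (r0); apply/eqP/(env b).
  rewrite hb lt0n -hb; apply: contraNneq r0 => /rank_inj /perm_inj e.
  by rewrite -{1}e hb.
have top i : i < rank (l a) (s a) -> is_top n entry (entry a i).
  move=> hi; have hin := ltn_trans hi (rank_lt a (s a)).
  rewrite (entryE a (Ordinal hin)); set y := tnth _ _.
  have ry : rank (l a) y = i by apply: rank_entry => //; rewrite (entryE a (Ordinal hin)).
  apply/is_topP; exists ((s^-1)%g y).
  by rewrite -{2}(permKV s y); apply: (env a); rewrite permKV ry.
case: (o1E (ltn_ord a)) => [[k [hk e ntk topk]]|[e alltop]]; last first.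
  by case/negP: nt; rewrite -(entry_rank a (s a)); apply: alltop; apply: rank_lt.
have [lt|gt|ek] := ltngtP k (rank (l a) (s a)).
- by case/negP: ntk; rewrite e; apply: top.
- by case/negP: nt; rewrite -(entry_rank a (s a)); apply: topk.
by rewrite e ek entry_rank.
Qed.

Lemma envied_feasible (s : {perm 'I_n}) :
  envied_get_top l s -> feasible n o0 o1.
Proof.
move=> /allowed_envied al.
pose T a := if insub a is Some x then val (s x) else 0.
have TE a (ha : a < n) : T a = s (Ordinal ha) by rewrite /T insubT.
exists T; split=> [a ha|a b ha hb]; first by rewrite TE; apply: (al (Ordinal ha)).
by rewrite !TE => /val_inj /perm_inj [].
Qed.

(** All [n] houses are occupied by distinct agents, so [who] is a permutation, and its inverse sends
    agents to houses. *)
Lemma housed_envied (who : nat -> nat) : housed n o0 o1 (fun a => a < n) n who ->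
  exists2 s : {perm 'I_n}, envied_get_top l s &
    forall h : 'I_n, who h = (s^-1)%g h :> nat.
Proof.
move=> hs; have all := housed_all hs; have [hA inj _] := hs.
pose f (h : 'I_n) := Ordinal (all h (ltn_ord h)).
have finj : injective f.
  by move=> h h' [e]; apply: val_inj; apply: inj e => //; apply: (all h).
exists ((perm finj)^-1)%g; last by move=> h; rewrite invgK permE.
apply/allowed_envied => a; set h := ((perm finj)^-1)%g a.
have <- : who h = a by rewrite -[RHS](congr1 val (permKV (perm finj) a)) permE.
by have [] := hA h (ltn_ord h) (all h (ltn_ord h)).
Qed.
End Preferences.

(** * The two programs *)

Definition solve_side (P : nat) : prog :=
  Then (setv 31 (Const 0)) (Then clear (Then (firsts P) (Then (seconds P) place))).

Lemma den_solve_side n (l : 'I_n -> n.-tuple 'I_n) P s :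
  (forall a, uniq (l a)) -> P < 10 -> reads P n (entry l) s ->
  (den (solve_side P) s 31 0 = 0 /\
   exists2 t : {perm 'I_n}, envied_get_top l t &
     forall h : 'I_n, den (solve_side P) s 23 h = (t^-1)%g h :> nat) \/
  (den (solve_side P) s 31 0 != 0 /\ forall t, ~ envied_get_top l t).
Proof.
move=> ul hP r0; set s1 := den (setv 31 (Const 0)) s.
have r1 : reads P n (entry l) s1 by apply: reads_den.
set s2 := den clear s1; have r2 : reads P n (entry l) s2 by apply: reads_den.
set s3 := den (firsts P) s2; have r3 : reads P n (entry l) s3 by apply: reads_den.
set s4 := den (seconds P) s3; have r4 : reads P n (entry l) s4 by apply: reads_den.
have c := den_clear r1.
have Llt := @entry_lt n l.
have t3 : tops_set n (entry l) s3.
  by apply: den_firsts => // h hh; have [] := c h hh.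
have o1E := den_seconds hP Llt r3 t3; rewrite -/s4 in o1E.
have o0E a : a < n -> s4 20 a = entry l a 0.
  by rewrite /s4 den_frame //; apply: t3.1.
have o0lt a : a < n -> s4 20 a < n.
  by move=> ha; rewrite o0E // Llt // (leq_ltn_trans _ ha).
have o1lt a : a < n -> s4 21 a < n.
  move=> ha; have n0 : 0 < n by apply: leq_ltn_trans ha.
  by case: (o1E a ha) => [[k [hk -> _ _]]|[-> _]]; apply: Llt.
have s31 : s4 31 0 = 0 by rewrite /s4 den_frame // /s3 den_frame // /s2 den_frame.
have s23 h : h < n -> s4 23 h = n.
  by move=> hh; rewrite /s4 den_frame // /s3 den_frame //; have [] := c h hh.
have set4 : setting n (s4 20) (s4 21) s4 by split=> //; exact: r4.1.
have -> : den (solve_side P) s = den place s4 by [].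
case: (den_place o0lt o1lt set4 s31 s23) => [[-> hs]|[hf inf]]; [left|right]; split=> //.
  exact: (housed_envied ul o0E o1E hs).
by move=> t /(envied_feasible ul o0E o1E).
Qed.

(** The second run of [solve_side] reuses array 23. *)
Definition save : prog := For 24 (Do 7 (var 24) (Get 23 (var 24))).

(** Triples are listed by their member in [B]: array 7 gives its holder in [A], and array 10, the
    inverse of array 23, its partner in [C]. *)
Definition output : prog :=
  Then (For 24 (Do 10 (Get 23 (var 24)) (var 24)))
  (Then (For 24 (Then (Do 5 (Mul (Const 3) (var 24)) (Get 7 (var 24)))
     (Then (Do 5 (Add (Mul (Const 3) (var 24)) (Const 1)) (var 24))
        (Do 5 (Add (Mul (Const 3) (var 24)) (Const 2)) (Get 10 (var 24))))))
  (Then (setv 4 (var 0)) (setv 6 (Const 1)))).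

Definition compute : prog :=
  Then (solve_side 1) (Then save (Then (setv 8 (var 31)) (Then (solve_side 2)
    (Cond (var 8) Nop (Cond (var 31) Nop output))))).

Definition invert_step : prog :=
  Then (Do 7 (Get 5 (Add (Mul (Const 3) (var 24)) (Const 1)))
             (Get 5 (Mul (Const 3) (var 24))))
       (Do 8 (Get 5 (Add (Mul (Const 3) (var 24)) (Const 2)))
             (Get 5 (Add (Mul (Const 3) (var 24)) (Const 1)))).

(** Cell 6 starts at 0, so a matching with other than [n] triples is rejected at once. *)
Definition verify : prog :=
  Cond (Eq (var 4) (var 0))
    (Then (setv 6 (Const 1))
    (Then (For 24 invert_step)
    (Then (check 1 7) (check 2 8))))
    Nop.

Lemma wf_programs : [/\ wf compute, depth compute <= 2, wf verify & depth verify <= 2].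
Proof. by []. Qed.

Lemma bounded_load N (ls : seq (seq nat)) :
  all (all (fun v => v <= N)) ls -> bounded N (load ls).
Proof.
move=> h x i; rewrite /load.
have hx : all (fun v => v <= N) (nth [::] ls x).
  have [lt|ge] := ltnP x (size ls); last by rewrite nth_default.
  by move/allP: h; apply; apply: mem_nth.
have [lt|ge] := ltnP i (size (nth [::] ls x)); last by rewrite nth_default.
by move/allP: hx; apply; apply: mem_nth.
Qed.

Lemma encode_prefs_le n (l : 'I_n -> n.-tuple 'I_n) :
  all (fun v => v <= n.+1) (encode_prefs l).
Proof.
apply/allP => v /flattenP[_ /mapP[x _ ->] /mapP[y _ ->]].
exact: leqW (ltnW (ltn_ord y)).
Qed.

Lemma encode_triples_le n (ts : seq (triple n)) :
  all (fun v => v <= n.+1) (encode_triples ts).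
Proof.
apply/allP => v /flattenP[_ /mapP[t _ ->]].
by rewrite !inE => /or3P[] /eqP ->; apply/leqW/ltnW/ltn_ord.
Qed.

Lemma size_encode_triples n (ts : seq (triple n)) :
  size (encode_triples ts) = size ts * 3.
Proof. by elim: ts => //= t ts IH; rewrite mulSn -IH. Qed.

Lemma nth_encode_triples n (ts : seq (triple n)) t0 j r : j < size ts -> r < 3 ->
  nth 0 (encode_triples ts) (j * 3 + r) =
  nth 0 [:: val (nth t0 ts j).1.1; val (nth t0 ts j).1.2; val (nth t0 ts j).2] r.
Proof.
move=> hj hr; rewrite /encode_triples nth_flatten_blocks ?size_map //.
  by rewrite (nth_map t0).
by apply/allP => _ /mapP[x _ ->].
Qed.

Lemma input_sizeE n (I : instance n) : input_size I = 3 * n ^ 2.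
Proof.
have sum (l : 'I_n -> n.-tuple 'I_n) : \sum_(a < n) size (l a) = n * n.
  rewrite (eq_bigr (fun=> n)) => [|a _]; last exact: size_tuple.
  by rewrite sum_nat_const card_ord.
by rewrite /input_size !sum -mulnn; lia.
Qed.

Lemma den_save s n : s 0 0 = n -> forall h, h < n -> den save s 7 h = s 23 h.
Proof.
move=> sn; apply: (@den_for (fun i s' => forall h, h < i -> s' 7 h = s 23 h)) => //.
move=> i s1 hi xi fr Ii h; rewrite ltnS leq_eqVlt /update /= /update /= xi.
by rewrite fr //; case: eqP => [->|_ /Ii].
Qed.

Lemma den_output s n (u t : {perm 'I_n}) : s 0 0 = n ->
  (forall h : 'I_n, s 7 h = (u^-1)%g h :> nat) ->
  (forall h : 'I_n, s 23 h = (t^-1)%g h :> nat) ->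
  den output s 6 0 = 1 /\ outputs_matching (den output s) (perm_matching u t).
Proof.
move=> sn s7 s23.
set s1 := den (For 24 (Do 10 (Get 23 (var 24)) (var 24))) s.
have s1t : forall b : 'I_n, s1 10 b = t b.
  suff : forall c, c < n -> s1 10 (s 23 c) = c.
    by move=> h b; have := h _ (ltn_ord (t b)); rewrite s23 permK.
  apply: (@den_for (fun i s' => forall c, c < i -> s' 10 (s 23 c) = c)) => //.
  move=> i s' hi xi fr Ii c; rewrite ltnS leq_eqVlt /update /= /update /= xi fr //.
  have [-> _|ne] := eqVneq c i; first by rewrite eqxx.
  move=> /= hc; have hcn := ltn_trans hc hi.
  (* Array 23 is injective, so this write spares the earlier entries of the inverse. *)
  rewrite ifN ?Ii //; apply: contra ne.
  rewrite (s23 (Ordinal hcn)) (s23 (Ordinal hi)) => /eqP /val_inj /perm_inj [->].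
  exact: eqxx.
set body := Then (Do 5 (Mul (Const 3) (var 24)) (Get 7 (var 24)))
     (Then (Do 5 (Add (Mul (Const 3) (var 24)) (Const 1)) (var 24))
        (Do 5 (Add (Mul (Const 3) (var 24)) (Const 2)) (Get 10 (var 24)))).
have sn1 : s1 0 0 = n by rewrite /s1 den_frame.
set s2 := den (For 24 body) s1.
have s2out : forall b, b < n ->
    [/\ s2 5 (b * 3 + 0) = s1 7 b, s2 5 (b * 3 + 1) = b & s2 5 (b * 3 + 2) = s1 10 b].
  apply: (@den_for (fun i s' => forall b, b < i -> [/\ s' 5 (b * 3 + 0) = s1 7 b,
    s' 5 (b * 3 + 1) = b & s' 5 (b * 3 + 2) = s1 10 b])) => //.
  move=> i s' hi xi fr Ii b; rewrite ltnS => hb.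
  have s'7 : s' 7 = s1 7 by apply: fr.
  have s'10 : s' 10 = s1 10 by apply: fr.
  have wr j : update (den body s') 24 0 i.+1 5 j =
      if j == 3 * i + 2 then s1 10 i else
      if j == 3 * i + 1 then i else if j == 3 * i then s1 7 i else s' 5 j.
    by rewrite /update /= /update /= xi s'7 s'10.
  rewrite !wr; have [->|ne] := eqVneq b i.
    by split; do ?[case: eqP => //; try lia].
  have lt : b < i by rewrite ltn_neqAle ne.
  by have [e0 e1 e2] := Ii b lt; split; do ?[case: eqP => //; try lia].
set s3 := den output s.
have s3E : s3 = update (update s2 4 0 (s2 0 0)) 6 0 1 by [].
split; first by rewrite s3E.
exists [seq ((u^-1)%g b, b, t b) | b <- enum 'I_n].
have sz : size [seq ((u^-1)%g b, b, t b) | b <- enum 'I_n] = n.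
  by rewrite size_map -cardE card_ord.
split.
- split; first by rewrite map_inj_uniq ?enum_uniq // => b b' [_].
  move=> v; apply/mapP/imsetP => [[b _ ->]|[a _ ->]].
    by exists ((u^-1)%g b); rewrite ?permKV.
  by exists (u a); rewrite ?mem_enum ?permK.
- move=> [|] //= _; rewrite s3E /update /= /s2 den_frame // sn1.
  by rewrite -[in LHS]sz size_map.
move=> i; rewrite size_encode_triples sz => hi.
have hb : i %/ 3 < n by rewrite ltn_divLR.
pose b := Ordinal hb.
rewrite [i](divn_eq i 3) (nth_encode_triples (u b, b, b)) ?sz ?ltn_pmod //.
rewrite (nth_map b) -?cardE ?card_ord // (nth_ord_enum b b).
have [e0 e1 e2] := s2out b (ltn_ord b).
have -> : s3 5 = s2 5 by rewrite s3E !update_frame.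
have := ltn_pmod i (isT : 0 < 3); case: (i %% 3) => [|[|[|]]] //= _.
- by rewrite e0 /s1 den_frame // s7.
- by rewrite e2 s1t.
Qed.

(** * Correctness on encoded inputs *)

Section Programs.
Variables (n : nat) (I : instance n).

Lemma reads_A s : s 0 = load (encode_instance I) 0 -> s 1 = load (encode_instance I) 1 ->
  reads 1 n (entry (prefA I)) s.
Proof. by move=> e0 e1; rewrite /reads e0 e1. Qed.

Lemma reads_B s : s 0 = load (encode_instance I) 0 -> s 2 = load (encode_instance I) 2 ->
  reads 2 n (entry (prefB I)) s.
Proof. by move=> e0 e1; rewrite /reads e0 e1. Qed.

Lemma compute_correct (s := den compute (load (encode_instance I))) :
  (answer s = 1 /\ exists M : {set triple n},
     [/\ is_matching M, AB_popular I M & outputs_matching s M]) \/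
  (answer s = 0 /\ ~ exists M : {set triple n}, is_matching M /\ AB_popular I M).
Proof.
pose s0 := load (encode_instance I).
set s1 := den (solve_side 1) s0; set s2 := den save s1.
set s3 := den (setv 8 (var 31)) s2; set s4 := den (solve_side 2) s3.
have sE : s = if s4 8 0 != 0 then s4 else if s4 31 0 != 0 then s4 else den output s4.
  by [].
have s3A y : y \notin writes (setv 8 (var 31)) -> y \notin writes (solve_side 1) ->
    y \notin writes save -> s3 y = s0 y.
  by move=> h1 h2 h3; rewrite /s3 den_frame // /s2 den_frame // /s1 den_frame.
have s46 : s4 6 0 = 0 by rewrite /s4 den_frame // s3A.
have s48 : s4 8 0 = s1 31 0.
  by rewrite /s4 den_frame //= /s3 /= /update /= /s2 den_frame.
have s1n : s1 0 0 = n by rewrite /s1 den_frame.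
have s47 h : h < n -> s4 7 h = s1 23 h.
  by move=> hh; rewrite /s4 den_frame // /s3 den_frame // /s2 (den_save s1n).
have s4n : s4 0 0 = n by rewrite /s4 den_frame // s3A.
have r1 : reads 1 n (entry (prefA I)) s0 by apply: reads_A.
have r2 : reads 2 n (entry (prefB I)) s3 by apply: reads_B; apply: s3A.
(* A popular matching is full and yields a good bijection on each side, so failure on one side rules
   it out. *)
have nopop : (forall u, ~ envied_get_top (prefA I) u) \/
    (forall u, ~ envied_get_top (prefB I) u) ->
    ~ exists M : {set triple n}, is_matching M /\ AB_popular I M.
  move=> no [M [mM pop]].
  have [u [t e]] := full_matchingP mM (AB_popular_full mM pop).
  move: pop; rewrite e AB_popular_permP => -[hA hB].
  by case: no => [/(_ u)|/(_ t)].
case: (@den_solve_side n _ 1 s0 (@prefA_uniq n I) isT r1) => [[f1 [u hu eu]]|[f1 no]]; last first.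
  right; split; last by apply: nopop; left.
  by rewrite /answer sE s48 f1.
rewrite -/s1 in f1 eu.
case: (@den_solve_side n _ 2 s3 (@prefB_uniq n I) isT r2) => [[f2 [t ht et]]|[f2 no]]; last first.
  right; split; last by apply: nopop; right.
  by rewrite /answer sE s48 f1 /= f2.
rewrite -/s4 in f2 et.
left; have {}sE : s = den output s4 by rewrite sE s48 f1 f2.
have e7 (h : 'I_n) : s4 7 h = (u^-1)%g h by rewrite s47.
have [out6 outM] := den_output s4n e7 et.
split; first by rewrite /answer sE.
exists (perm_matching u t); split; first exact: is_matching_perm.
  by apply/AB_popular_permP.
by rewrite sE.
Qed.

(** The triples come in any order, but distinct ones differ in their [B] and [C] members, so no
    entry is overwritten. *)
Lemma den_invert s (ts : seq (triple n)) (u t : {perm 'I_n}) :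
  s 0 0 = n -> size ts = n -> ts =i perm_matching u t ->
  (forall j, s 5 j = nth 0 (encode_triples ts) j) ->
  forall h : 'I_n, den (For 24 invert_step) s 7 h = (u^-1)%g h /\
                   den (For 24 invert_step) s 8 h = (t^-1)%g h.
Proof.
move=> sn sz tsE s5 h.
pose t0 : triple n := (h, h, h).
pose v j := nth t0 ts j.
have vM j : j < n -> v j \in perm_matching u t.
  by move=> hj; rewrite -tsE mem_nth ?sz.
have [_ injB injC] := matching_proj_inj (is_matching_perm u t).
have uts : uniq ts.
  have sub : {subset enum (perm_matching u t) <= ts}.
    by move=> x; rewrite mem_enum tsE.
  apply: (leq_size_uniq (enum_uniq _) sub).
  by rewrite sz -cardE card_perm_matching.
have vinj j k : j < n -> k < n -> v j = v k -> j = k.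
  by move=> hj hk /eqP; rewrite nth_uniq ?sz // => /eqP.
have read j r : j < n -> r < 3 -> s 5 (3 * j + r) =
    nth 0 [:: val (v j).1.1; val (v j).1.2; val (v j).2] r.
  by move=> hj hr; rewrite s5 mulnC (nth_encode_triples t0) ?sz.
suff all : forall j, j < n ->
    den (For 24 invert_step) s 7 (v j).1.2 = (v j).1.1 /\
    den (For 24 invert_step) s 8 (v j).2 = (v j).1.2.
  have find a : exists2 j, j < n & v j = (a, u a, t (u a)).
    have vts : (a, u a, t (u a)) \in ts by rewrite tsE; apply: imset_f.
    exists (index (a, u a, t (u a)) ts); last exact: nth_index.
    by rewrite -[X in _ < X]sz index_mem.
  have [j hj ej] := find ((u^-1)%g h).
  have [k hk ek] := find ((u^-1)%g ((t^-1)%g h)).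
  have [eA _] := all j hj; have [_ eB] := all k hk.
  by move: eA eB; rewrite ej ek /= !permKV.
apply: (@den_for (fun i s' => forall j, j < i ->
    s' 7 (v j).1.2 = (v j).1.1 /\ s' 8 (v j).2 = (v j).1.2)) => //.
move=> i s' hi xi fr Ii j; rewrite ltnS => hj.
have s'5 : s' 5 = s 5 by apply: fr.
have r0 := read i 0 hi isT; have r1 := read i 1 hi isT; have r2 := read i 2 hi isT.
rewrite addn0 in r0.
have w7 k : update (den invert_step s') 24 0 i.+1 7 k =
    if k == (v i).1.2 then val (v i).1.1 else s' 7 k.
  by rewrite /update /= /update /= xi s'5 r0 r1.
have w8 k : update (den invert_step s') 24 0 i.+1 8 k =
    if k == (v i).2 then val (v i).1.2 else s' 8 k.
  by rewrite /update /= /update /= xi s'5 r1 r2.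
rewrite w7 w8; have [->|ne] := eqVneq j i; first by rewrite !eqxx.
have lt : j < i by rewrite ltn_neqAle ne.
have hjn := ltn_trans lt hi.
have [e7 e8] := Ii j lt.
split; rewrite ifN //; apply: contra ne => /eqP /val_inj e; apply/eqP/vinj => //.
  by apply: injB => //; apply: vM.
by apply: injC => //; apply: vM.
Qed.

Lemma verify_correct (M : {set triple n}) (ts : seq (triple n)) :
  is_matching M -> lists ts M ->
  answer (den verify (load (encode_input I ts))) = if AB_popular I M then 1 else 0.
Proof.
move=> mM [uts tsM]; pose s0 := load (encode_input I ts).
have szM : size ts = #|M| by rewrite -(card_uniqP uts); apply: eq_card.
set s1 := den (setv 6 (Const 1)) s0; set s2 := den (For 24 invert_step) s1.
set s3 := den (check 1 7) s2; set s4 := den (check 2 8) s3.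
have sE : den verify s0 = if size ts == n then s4 else s0.
  transitivity (if (size ts == n : nat) != 0 then s4 else s0); first by [].
  by case: (size ts == n).
rewrite /answer sE; have [szn|szn] := eqVneq (size ts) n; last first.
  case: ifP => // pop; case/eqP: szn.
  by rewrite szM; apply: AB_popular_full pop.
have [u [t eM]] : exists u t, M = perm_matching u t.
  by apply: full_matchingP mM _; rewrite -szM.
have inv := @den_invert s1 ts u t erefl szn.
have {}inv (h : 'I_n) : s2 7 h = (u^-1)%g h /\ s2 8 h = (t^-1)%g h.
  by apply: inv => // x; rewrite -eM.
pose wA h := s2 7 h; pose wB h := s2 8 h.
have Llt l := @entry_lt n l.
have r1 : reads 1 n (entry (prefA I)) s2.
  by apply: reads_A; rewrite /s2 den_frame // /s1 update_frame.
have r2 : reads 2 n (entry (prefB I)) s3.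
  by apply: reads_B; rewrite /s3 den_frame // /s2 den_frame // /s1 update_frame.
have ltA h : h < n -> wA h < n.
  by move=> hh; rewrite /wA (inv (Ordinal hh)).1.
have ltB h : h < n -> wB h < n.
  by move=> hh; rewrite /wB (inv (Ordinal hh)).2.
have c1 := @den_check 1 7 isT isT s2 n (entry (prefA I)) wA r1.1 r1.2 (@Llt _)
  (fun _ _ => erefl) ltA.
have s38 h : h < n -> s3 8 h = wB h by move=> _; rewrite /s3 den_frame.
have c2 := @den_check 2 8 isT isT s3 n (entry (prefB I)) wB r2.1 r2.2 (@Llt _)
  s38 ltB.
have s26 : s2 6 0 = 1 by rewrite /s2 den_frame.
rewrite /s4 c2 /s3 c1 s26 mul1n mulnb.
have eA := envy_checkP (@prefA_uniq n I) (fun h => (inv h).1).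
have eB := envy_checkP (@prefB_uniq n I) (fun h => (inv h).2).
suff -> : AB_popular I M = envy_check n (entry (prefA I)) wA n
    && envy_check n (entry (prefB I)) wB n by case: (_ && _).
rewrite eM; apply/idP/andP => [/AB_popular_permP[hA hB]|[/eA hA /eB hB]].
  by split; [apply/eA|apply/eB].
exact/AB_popular_permP.
Qed.

End Programs.

Theorem theorem6 :
  (exists (verify : cmd) (k : nat),
     forall (n : nat) (I : instance n) (M : {set triple n}) (ts : seq (triple n)),
       is_matching M -> lists ts M ->
       halts_within (k * (input_size I + 1)) (k * (input_size I + 1))
         verify (load (encode_input I ts))
         (fun s => answer s = if AB_popular I M then 1 else 0))
  /\
  (exists (compute : cmd) (k : nat),
     forall (n : nat) (I : instance n),
       halts_within (k * (input_size I + 1)) (k * (input_size I + 1))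
         compute (load (encode_instance I))
         (fun s =>
            (answer s = 1 /\
             exists M : {set triple n},
               [/\ is_matching M, AB_popular I M & outputs_matching s M])
            \/
            (answer s = 0 /\
             ~ exists M : {set triple n}, is_matching M /\ AB_popular I M))).
Proof.
have [wfc dc wfv dv] := wf_programs.
split.
  have [k lin] := exec_linear wfv dv.
  exists (code verify), k => n I M ts mM lM; rewrite input_sizeE.
  apply: lin => //; last exact: verify_correct.
  apply: bounded_load; rewrite /encode_input /= !encode_prefs_le encode_triples_le.
  have [uts tsM] := lM.
  (* The stored number of triples is the size of a matching, hence at most [n]. *)
  have -> : size ts = #|M| by rewrite -(card_uniqP uts); apply: eq_card.
  by rewrite leqnSn leqW // card_matching.
have [k lin] := exec_linear wfc dc.
exists (code compute), k => n I; rewrite input_sizeE.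
apply: lin => //; last exact: compute_correct.
by apply: bounded_load; rewrite /encode_instance /= !encode_prefs_le leqnSn.
Qed.
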